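(* Let $G$ be a matrix Lie group (a closed subgroup of $\mathrm{GL}(d)$ for some $d$) with surjective exponential map, and let $\mathfrak{g}$ be its Lie algebra. A smooth vector field $f : G \rightarrow \mathfrak{g}$ (generating the dynamics $\dot{g} = f(g)$ on $G$) is group-affine, i.e. satisfies $$f(g_1 g_2) = f(g_1)\, g_2 + g_1 f(g_2) - g_1 f(I)\, g_2 \quad \text{for all } g_1, g_2 \in G,$$ where $I$ is the identity of $G$, if and only if there exist a derivation $D : \mathfrak{g} \rightarrow \mathfrak{g}$ (a linear map with $D[X,Y] = [DX,Y] + [X,DY]$) and elements $Y_1, Y_2 \in \mathfrak{g}$ such that, for all $X \in \mathfrak{g}$, $$f(e^X) = e^X J_{\mathfrak{g}}(X)\, D X + e^X Y_1 + Y_2\, e^X,$$ where $J_{\mathfrak{g}}(X) = \int_0^1 e^{-s\,\mathrm{ad}_X}\, \mathrm{d}s$ is the Jacobian of the exponential map and $\mathrm{ad}_X Y = [X,Y] = XY - YX$. As a consequence, for a group-affine vector field, if $g(t)$ solves $\dot g = f(g)$ and is written as $g(t) = e^{X(t)}\mu(t)$, where $\mu(t)$ also solves $\dot\mu = f(\mu)$ (with known $\mu(0) = \mu_0$) and $X(0) = X_0 \in \mathfrak{g}$, then the equation $\dot{X} = J_{\mathfrak{g}}^{-1}(X)\,(e^{-X} f(e^X) - f(I))$ satisfied by $X$ simplifies to the linear equation $$\dot{X} = (D + \mathrm{ad}_{Y_2})\, X, \qquad X(0) = X_0 \in \mathfrak{g}.$$ The appearance of $Y_2$ rather than $Y_1$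 is a consequence of representing $g$ as $e^X \mu$ instead of $\mu e^X$.
   Context: $G$ is a matrix Lie group of dimension $n$ with surjective exponential map and Lie algebra $\mathfrak{g}$. The exponential map is the matrix exponential. The derivative of the exponential map along a $C^1$ path $X(t)$ in $\mathfrak{g}$ is $\frac{\mathrm{d}}{\mathrm{d}t} e^{X(t)} = e^{X(t)} J_{\mathfrak{g}}(X(t))\dot{X}(t)$. A derivation on $\mathfrak{g}$ is a linear map $D$ satisfying $D[X,Y] = [DX,Y] + [X,DY]$. *)

(* Defs.v *)
From HB Require Import structures.
From mathcomp Require Import all_boot all_order all_algebra.
From mathcomp Require Import all_classical all_reals all_analysis.
Set Implicit Arguments. Unset Strict Implicit. Unset Printing Implicit Defensive.
Import Order.TTheory GRing.Theory Num.Theory.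
Import numFieldNormedType.Exports.
Local Open Scope classical_set_scope.
Local Open Scope ring_scope.

Section MatrixLie.
Variables (R : realType) (d : nat).
Local Notation M := 'M[R]_d.

Definition mxpow (A : M) (k : nat) : M := iter k (mulmx A) 1%:M.

Definition expm (A : M) : M :=
  lim ((fun N : nat => \sum_(k < N) (k`!%:R)^-1 *: mxpow A k) @ \oo).

Definition lie_br (X Y : M) : M := X *m Y - Y *m X.
Definition ad (X : M) : M -> M := lie_br X.

Definition opexp (L : M -> M) (V : M) : M :=
  lim ((fun N : nat => \sum_(k < N) (k`!%:R)^-1 *: iter k L V) @ \oo).

Definition Jexp (X : M) (V : M) : M :=
  \matrix_(i < d, j < d)
    (\int[@lebesgue_measure R]_(s in `[0, 1]) (opexp (fun W => - (s *: ad X W)) V) i j).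

Definition closed_subgroup_GL (G : set M) : Prop :=
  [/\ G 1%:M,
      (forall g h, G g -> G h -> G (g *m h)),
      (forall g, G g -> g \in unitmx /\ G (invmx g)) &
      closure G `&` [set g | g \in unitmx] `<=` G].

Definition lie_alg (G : set M) : set M :=
  [set X | forall t : R, G (expm (t *: X))].

Definition exp_surjective (G : set M) : Prop :=
  forall g, G g -> exists X, lie_alg G X /\ expm X = g.

Fixpoint dder (vs : seq M) (F : M -> M) : M -> M :=
  if vs is v :: vs' then fun x => derive (dder vs' F) x v else F.

Definition smooth_on (S : set M) (F : M -> M) : Prop :=
  forall vs : seq M, (forall v, v \in vs -> S v) ->
    (forall x v, S x -> S v -> derivable (dder vs F) x v) /\
    {within S, continuous (dder vs F)}.

(* f is a smooth vector field on G: f(g) is tangent at g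
   (g^{-1} f(g) in the Lie algebra), and f is smooth on G, i.e. in the
   charts X |-> g e^X (X in the Lie algebra) around every g in G. *)
Definition smooth_vector_field (G : set M) (f : M -> M) : Prop :=
  (forall g, G g -> lie_alg G (invmx g *m f g)) /\
  (forall g, G g -> smooth_on (lie_alg G) (fun X => f (g *m expm X))).

Definition group_affine (G : set M) (f : M -> M) : Prop :=
  forall g1 g2, G g1 -> G g2 ->
    f (g1 *m g2) = f g1 *m g2 + g1 *m f g2 - g1 *m f 1%:M *m g2.

Definition derivation_on (S : set M) (D : M -> M) : Prop :=
  [/\ (forall X, S X -> S (D X)),
      (forall (a : R) X Y, S X -> S Y -> D (a *: X + Y) = a *: D X + D Y) &
      (forall X Y, S X -> S Y -> D (lie_br X Y) = lie_br (D X) Y + lie_br X (D Y))].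

Definition affine_repr (G : set M) (f : M -> M) (D : M -> M) (Y1 Y2 : M) : Prop :=
  [/\ derivation_on (lie_alg G) D, lie_alg G Y1, lie_alg G Y2 &
      forall X, lie_alg G X ->
        f (expm X) = expm X *m Jexp X (D X) + expm X *m Y1 + Y2 *m expm X].

End MatrixLie.

(* Main.v *)
Require Import Defs.
From HB Require Import structures.
From mathcomp Require Import all_boot all_order all_algebra.
From mathcomp Require Import all_classical all_reals all_analysis.
From mathcomp Require Import ring lra.
Set Implicit Arguments.
Unset Strict Implicit.
Unset Printing Implicit Defensive.
Import Order.TTheory GRing.Theory Num.Theory.
Import numFieldNormedType.Exports.
Local Open Scope classical_set_scope.
Local Open Scope ring_scope.

(* Everything is left-trivialized: [J_X V] is the value at [1] of the primitive of
   [e^{-sX} V e^{sX}], and [d/dt e^{X(t)} = e^X J_X X'].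

   If [f] is group-affine with [c = f(I)], put [D X = d/dt|_0 f(e^{tX}) - X c]. It is
   additive because [f] is [C^1] in the exponential chart, and differentiating
   [f(g e^{tY} g^-1)] along [g = e^{sX}] shows that it is a derivation. As
   [e^{-tX} f(e^{tX}) - c] has derivative [e^{-tX} (D X) e^{tX}], it equals [J_X (D X)]
   at [t = 1], so that [Y1 = c] and [Y2 = 0] work.

   Conversely it suffices that, for all [g] in [G],
     [d/dr|_0 f(g e^{rY}) = g (D Y + [Y, Y1]) + f(g) Y]:
   then [(f(g e^{tY}) - g f(e^{tY})) e^{-tY}] is constant in [t]. At [g = e^S] with [J_S]
   injective on the Lie algebra, [g e^{rY} = e^{S + W(r)}] for a differentiable curve [W]
   in the Lie algebra (the closed subgroup theorem), and the formula follows from the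
   derivative of [X |-> J_X (D X)]; this is where the derivation property is used. For an
   arbitrary [g = e^Z], [J_{sZ}] is injective for some [s < 1] arbitrarily close to [1],
   and one passes to the limit in the chart at [g].

   For the error equation, [e^{-X} Y2 e^X - Y2 = J_X [Y2, X]], so that the equation
   becomes [J_X X' = J_X (D X + [Y2, X])]. *)

(** * Calculus of matrix-valued functions *)

(** The obstacle is that the representation is written in the coordinate X of e^X, which degenerates
    where J_X is singular: there a curve in G need not be the exponential of a differentiable curve,
    and the formula for f cannot be differentiated directly. Smoothness of f carries the result
    across, since the derivative of f in the chart at g is continuous. The curve in the converse is
    constant because the term g (D Y + [Y, Y1]) is multiplied on the left by the base point: it
    cancels between f(g e^{tY}) and g f(e^{tY}), whose difference q then satisfies q' = q Y. Taking
    Y2 = 0 loses nothing: as e^{-X} Y2 e^X = Y2 + J_X [Y2, X], the triples (D, Y1, Y2) and (D +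
    ad_{Y2}, Y1 + Y2, 0) represent the same field, and D + ad_{Y2} is the operator of the error
    equation. *)

Section MatrixAnalysis.
Context {R : realType} {d : nat}.
Local Notation M := 'M[R]_d.
Implicit Types (A B X V : M) (phi psi : R -> M).

Lemma mx_norm_leP A (c : R) :
  0 <= c -> `|A| <= c <-> forall i j, `|A i j| <= c.
Proof.
move=> c0; rewrite /Num.Def.normr/= mx_normrE; split.
  by move=> /bigmax_leP[_ h] i j; exact: (h (i, j)).
by move=> h; apply: bigmax_le => // -[i j] _ /=; exact: h.
Qed.

Lemma mx_entry_le A i j : `|A i j| <= `|A|.
Proof. by have /mx_norm_leP := lexx `|A|; apply. Qed.

(** The norm is the largest absolute value of an entry, so it is submultiplicative only up to the
    dimension: hence the factors [d%:R] in the constants below. *)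
Lemma mx_norm_mul A B : `|A *m B| <= d%:R * `|A| * `|B|.
Proof.
apply/mx_norm_leP => [|i j]; first by rewrite !mulr_ge0.
rewrite mxE (le_trans (ler_norm_sum _ _ _))//.
apply: (@le_trans _ _ (\sum_(k < d) `|A| * `|B|)).
  by apply: ler_sum => k _; rewrite normrM ler_pM// mx_entry_le.
by rewrite sumr_const card_ord -mulrA -[leLHS]mulr_natl.
Qed.

Lemma mx_norm1 : `|1%:M : M| <= 1.
Proof.
apply/mx_norm_leP => // i j; rewrite mxE.
by case: (i == j); rewrite /= ?mulr1n ?mulr0n ?normr1 ?normr0.
Qed.

Lemma linear_bounded (L : {linear M -> M}) :
  exists2 C : R, 0 <= C & forall V, `|L V| <= C * `|V|.
Proof.
exists (\sum_i \sum_j `|L (delta_mx i j)|).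
  by apply: sumr_ge0 => i _; apply: sumr_ge0 => j _.
move=> V; rewrite {1}(matrix_sum_delta V) linear_sum/= mulr_suml.
rewrite (le_trans (ler_norm_sum _ _ _))// ler_sum// => i _.
rewrite linear_sum/= mulr_suml (le_trans (ler_norm_sum _ _ _))// ler_sum// => j _.
by rewrite linearZ/= normrZ mulrC ler_wpM2l// mx_entry_le.
Qed.

Lemma mx_cvgP {T : Type} (F : set_system T) {FF : Filter F} (u : T -> M) (l : M) :
  (u @ F --> l) <-> (forall i j, (fun x => u x i j) @ F --> l i j).
Proof.
split=> [/cvgrPdist_le ul i j|ul]; apply/cvgrPdist_le => /= e e0.
  near=> n; rewrite (le_trans _ (_ : `|l - u n| <= e))//.
    by have := mx_entry_le (l - u n) i j; rewrite !mxE.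
  by near: n; exact: ul.
near=> n; apply/mx_norm_leP => [|i j]; first exact: ltW.
rewrite !mxE; move: i j; near: n.
apply: filter_forall => i; apply: filter_forall => j.
by have /cvgrPdist_le := ul i j; exact.
Unshelve. all: by end_near. Qed.

Lemma cvg_mulmx {T : Type} (F : set_system T) {FF : Filter F} (u v : T -> M) A B :
  u @ F --> A -> v @ F --> B -> (fun x => u x *m v x) @ F --> A *m B.
Proof.
move=> /mx_cvgP uA /mx_cvgP vB; apply/mx_cvgP => i j; rewrite mxE.
rewrite (_ : (fun x => _) = fun x => \sum_k u x i k * v x k j); last first.
  by apply/funext => x; rewrite mxE.
apply: cvg_big => [|k _]; first exact: add_continuous.
by apply: cvgM; [exact: uA|exact: vB].
Qed.

Lemma cvg_linear {T : Type} (F : set_system T) {FF : Filter F} (u : T -> M) A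
  (L : {linear M -> M}) : u @ F --> A -> (fun x => L (u x)) @ F --> L A.
Proof.
have [C C0 hL] := linear_bounded L.
move=> /cvgrPdist_le uA; apply/cvgrPdist_le => /= e e0.
have e'0 : 0 < e / (C + 1) by rewrite divr_gt0// ltr_wpDl.
near=> x; rewrite -linearB (le_trans (hL _))//.
rewrite (@le_trans _ _ (C * (e / (C + 1))))//.
  by rewrite ler_wpM2l//; near: x; exact: uA.
rewrite mulrCA ler_piMr ?(ltW e0)//.
by rewrite ler_pdivrMr ?mul1r ?lerDl// ltr_wpDl.
Unshelve. all: by end_near. Qed.

Lemma is_derive_mxP phi (t : R) V :
  is_derive t 1 phi V <-> forall i j, is_derive t 1 (fun s => phi s i j) (V i j).
Proof.
split=> [[dphi <-] i j|h].
  by split; [exact: (derivable_mxP _ _ _).1|rewrite derive_mx// mxE].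
have dphi : derivable phi t 1.
  by apply/derivable_mxP => i j; have [] := h i j.
split=> //; rewrite derive_mx//; apply/matrixP => i j; rewrite mxE.
by have [] := h i j.
Qed.

Lemma is_derive_mulmx phi psi (t : R) A B :
  is_derive t 1 phi A -> is_derive t 1 psi B ->
  is_derive t 1 (fun s => phi s *m psi s) (A *m psi t + phi t *m B).
Proof.
move=> /is_derive_mxP dphi /is_derive_mxP dpsi; apply/is_derive_mxP => i j.
rewrite (_ : (fun s => _) = \sum_k (fun s => phi s i k * psi s k j)); last first.
  by apply/funext => s; rewrite mxE fct_sumE.
rewrite !mxE -big_split/=.
apply: is_derive_sum => k.
have := @is_deriveM _ _ _ _ _ _ _ _ (dphi i k) (dpsi k j).
move=> /is_derive_eq; apply.
by rewrite /= addrC /GRing.scale/= [_ * A _ _]mulrC.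
Qed.

Lemma is_derive_lin (L : {linear M -> M}) phi (t : R) A :
  is_derive t 1 phi A -> is_derive t 1 (fun s => L (phi s)) (L A).
Proof.
move=> /is_derive_mxP dphi'.
have Lsum V : L V = \sum_i \sum_j V i j *: L (delta_mx i j).
  rewrite {1}(matrix_sum_delta V) linear_sum/=; apply: eq_bigr => i _.
  by rewrite linear_sum/=; apply: eq_bigr => j _; rewrite linearZ.
apply/is_derive_mxP => k l.
rewrite (_ : (fun s => _) =
    \sum_i \sum_j (fun s => phi s i j * L (delta_mx i j) k l)); last first.
  apply/funext => s; rewrite Lsum summxE fct_sumE; apply: eq_bigr => i _.
  by rewrite summxE fct_sumE; apply: eq_bigr => j _; rewrite mxE.
rewrite Lsum summxE; apply: is_derive_sum => i.
rewrite summxE; apply: is_derive_sum => j; rewrite mxE.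
have [dij <-] := dphi' i j.
have -> : (fun s => phi s i j * L (delta_mx i j) k l) =
    L (delta_mx i j) k l *: (fun s => phi s i j).
  by apply/funext => s; rewrite mulrC.
by rewrite [X in is_derive _ _ _ X]mulrC; apply: is_deriveZ.
Qed.

Lemma is_derive_mx0_cst phi :
  (forall t : R, is_derive t 1 phi 0) -> forall s t, phi s = phi t.
Proof.
move=> h s t; apply/matrixP => i j.
apply: (@is_derive_0_is_cst _ (fun s => phi s i j)) => x.
by have /is_derive_mxP/(_ i j) := h x; rewrite mxE.
Qed.

(** Each entry has its own intermediate point, but the maximum norm lets the inequality survive with
    the same constant. *)
Lemma mx_MVT_le phi dphi (a b C : R) : a <= b -> 0 <= C ->
  (forall s, a <= s <= b -> is_derive s 1 phi (dphi s)) ->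
  (forall s, a <= s <= b -> `|dphi s| <= C) ->
  `|phi b - phi a| <= C * (b - a).
Proof.
move=> ab C0 dp bd; apply/mx_norm_leP => [|i j].
  by rewrite mulr_ge0// subr_ge0.
rewrite !mxE.
have dpij s : a <= s <= b -> is_derive s 1 (fun s => phi s i j) (dphi s i j).
  by move=> /dp/is_derive_mxP.
have [||c] := @MVT_segment R (fun s => phi s i j) (fun s => dphi s i j) a b ab.
- by move=> x /[!in_itv]/= /andP[/ltW ax /ltW xb]; apply: dpij; rewrite ax xb.
- apply: derivable_within_continuous => x /[!in_itv]/= xab.
  by have [] := dpij x xab.
- move=> /[!in_itv]/= cab ->; rewrite normrM [`|b - a|]ger0_norm ?subr_ge0//.
  by rewrite ler_wpM2r ?subr_ge0// (le_trans (mx_entry_le _ _ _))// bd.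
Qed.

(** Division-free form, meaningful also at [h = 0], in which derivatives are estimated below. *)
Lemma is_derive_dist_le phi (t : R) V : is_derive t 1 phi V <->
  forall e : R, 0 < e -> exists2 del : R, 0 < del &
    forall h, `|h| < del -> `|phi (t + h) - phi t - h *: V| <= e * `|h|.
Proof.
split=> [[/cvg_ex[/= l phil] lV]|h].
  have {}lV : l = V by rewrite -lV; apply/esym/cvg_lim.
  move: phil; rewrite {}lV => /cvgrPdist_le phil e e0.
  have [/= del del0 hd] := phil e e0.
  exists del => // h hdel; have [->|h0] := eqVneq h 0.
    by rewrite addr0 subrr scale0r subr0 !normr0 mulr0.
  have /= := hd h; rewrite sub0r normrN => /(_ hdel h0).
  rewrite [_%:A]mulr1 [h + t]addrC => hh.
  rewrite -(@ler_pM2l _ `|h^-1|) ?normr_gt0 ?invr_eq0// -normrZ.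
  rewrite scalerBr scalerA mulVf// scale1r distrC (le_trans hh)//.
  by rewrite mulrCA -normrM mulVf// normr1 mulr1.
suff phil : (h^-1 *: ((phi \o shift t) (h *: 1) - phi t)) @[h --> 0^'] --> V.
  by split; [apply/cvg_ex; exists V|exact/cvg_lim].
apply/cvgrPdist_le => e e0; have [del del0 hd] := h e e0.
near=> s; have s0 : s != 0 by near: s; exact: nbhs_dnbhs_neq.
have sdel : `|s| < del by near: s; exact: dnbhs0_lt.
rewrite /= [_%:A]mulr1 [s + t]addrC.
rewrite -(@ler_pM2l _ `|s|) ?normr_gt0// -normrZ scalerBr scalerA mulfV//.
by rewrite scale1r distrC mulrC; exact: hd.
Unshelve. all: by end_near. Qed.

Lemma is_derive_near phi psi (t r : R) V : 0 < r ->
  (forall h : R, `|h| < r -> phi (t + h) = psi (t + h)) ->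
  is_derive t 1 phi V -> is_derive t 1 psi V.
Proof.
move=> r0 E /is_derive_dist_le dphi; apply/is_derive_dist_le => e e0.
have [del del0 hd] := dphi e e0; exists (Num.min del r); first by rewrite lt_min del0.
move=> h; rewrite lt_min => /andP[/hd + hr]; rewrite E//.
by have := E 0; rewrite normr0 addr0 => ->.
Qed.

Lemma is_derive_cvg phi (t : R) V : is_derive t 1 phi V ->
  phi @ t --> phi t.
Proof.
move=> /is_derive_mxP dphi; apply/mx_cvgP => i j.
have [h _] := dphi i j.
exact/differentiable_continuous/derivable1_diffP.
Qed.

Lemma is_derive_line (F : M -> M) X V (t : R) : derivable F (X + t *: V) V ->
  is_derive t 1 (fun s : R => F (X + s *: V)) ('D_V F (X + t *: V)).
Proof.
have E (h : R) : ((fun s : R => F (X + s *: V)) \o shift t) (h *: 1) =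
    (F \o shift (X + t *: V)) (h *: V).
  by rewrite /= [_%:A]mulr1 scalerDl addrCA.
by move=> dF; split; rewrite /derivable /derive; under eq_fun do rewrite E.
Qed.

Lemma is_derive_lineZ A V (t : R) : is_derive t 1 (fun s : R => A + s *: V) V.
Proof.
apply/is_derive_dist_le => e e0; exists 1 => // h _.
rewrite opprD addrACA subrr add0r -scalerBl addrAC subrr add0r subrr normr0.
by rewrite mulr_ge0// ltW.
Qed.

Lemma is_derive_scale A (t : R) : is_derive t 1 (fun s : R => s *: A) A.
Proof.
have /is_derive_eq := is_derive_lineZ 0 A t; move/(_ A erefl).
by under [X in is_derive _ _ X _]eq_fun do rewrite add0r.
Qed.

End MatrixAnalysis.

(** * Power series of exponential type *)

Section ExponentialSeries.
Context {R : realType} {d : nat}.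
Local Notation M := 'M[R]_d.
Implicit Types (A B X V : M) (c : nat -> M).

(** With the factorial in the coefficients, differentiating [expser c] merely shifts [c]. Taking c_k
    = L^k V gives [expm] and [opexp]; a shift of index gives the primitive [Jf]. *)
Definition expcoef (c : nat -> M) i j : R^nat := fun k => (k`!%:R)^-1 * c k i j.

Definition expser (c : nat -> M) (t : R) : M :=
  \matrix_(i, j) limn (pseries (expcoef c i j) t).

Definition geo_bounded c := exists C K : R,
  [/\ 0 <= C, 0 <= K & forall k, `|c k| <= C * K ^+ k].

Lemma geo_bounded_shift c : geo_bounded c -> geo_bounded (c \o S).
Proof.
move=> [C [K [C0 K0 cC]]]; exists (C * K), K; split=> //; first exact: mulr_ge0.
by move=> k /=; rewrite (le_trans (cC _))// exprS mulrA.
Qed.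

Lemma expser_bound c (C K t : R) i j : 0 <= C -> 0 <= K ->
  (forall k, `|c k| <= C * K ^+ k) ->
  cvgn (pseries (expcoef c i j) t) /\
  `|limn (pseries (expcoef c i j) t)| <= C * expR (K * `|t|).
Proof.
move=> C0 K0 cC.
have le_u n : `|expcoef c i j n * t ^+ n| <= C * exp_coeff (K * `|t|) n.
  rewrite /exp_coeff /= exprMn !normrM normrX ger0_norm ?invr_ge0//.
  rewrite [leRHS](_ : _ = n`!%:R^-1 * (C * K ^+ n) * `|t| ^+ n); last by ring.
  rewrite ler_wpM2r ?exprn_ge0// ler_wpM2l ?invr_ge0//.
  exact: le_trans (mx_entry_le _ _ _) (cC n).
have cexp : cvgn (series (fun n => C * exp_coeff (K * `|t|) n)).
  by have := @is_cvg_seriesZ R _ C (@is_cvg_series_exp_coeff R (K * `|t|)).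
have cnorm : cvgn [normed pseries (expcoef c i j) t].
  apply: series_le_cvg cexp => n /=; [by []| |exact: le_u].
  by rewrite mulr_ge0// exp_coeff_ge0// mulr_ge0.
have cu : cvgn (pseries (expcoef c i j) t) by exact: normed_cvg.
split=> //; apply: le_trans (@lim_series_norm _ R^o _ cnorm) _.
rewrite (_ : C * _ = limn (series (fun n => C * exp_coeff (K * `|t|) n))).
  exact: lim_series_le.
by apply/esym;
  have := @lim_seriesZ R _ C (@is_cvg_series_exp_coeff R (K * `|t|)).
Qed.

Lemma expser_norm c (C K t : R) : 0 <= C -> 0 <= K ->
  (forall k, `|c k| <= C * K ^+ k) -> `|expser c t| <= C * expR (K * `|t|).
Proof.
move=> C0 K0 cC; apply/mx_norm_leP => [|i j]; first by rewrite mulr_ge0 ?expR_ge0.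
by rewrite mxE; have [] := expser_bound t i j C0 K0 cC.
Qed.

Lemma is_derive_expser c (t : R) : geo_bounded c ->
  is_derive t 1 (expser c) (expser (c \o S) t).
Proof.
move=> cC; apply/is_derive_mxP => i j.
have diffs c' : pseries_diffs (expcoef c' i j) = expcoef (c' \o S) i j.
  apply/funext => n; rewrite /pseries_diffs /expcoef /= factS natrM invfM.
  by rewrite mulrA mulrA mulrV ?mul1r// unitfE.
have cvs c' s : geo_bounded c' -> cvgn (pseries (expcoef c' i j) s).
  by move=> [C [K [C0 K0 h]]]; have [] := expser_bound s i j C0 K0 h.
rewrite (_ : (fun s => _) = fun s => limn (pseries (expcoef c i j) s)); last first.
  by apply/funext => s; rewrite mxE.
(* Termwise differentiation asks for convergence of the series and of its first two formal
   derivatives at a point of larger modulus than [t]. *)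
rewrite mxE -diffs; apply: (@pseries_snd_diffs _ _ (`|t| + 1)).
- exact: cvs.
- by rewrite diffs; apply: cvs; exact: geo_bounded_shift.
- by rewrite !diffs; apply: cvs; do 2 apply: geo_bounded_shift.
- by rewrite [ltRHS]ger0_norm ?addr_ge0// ltrDl.
Qed.

Lemma expser0 c : expser c 0 = c 0%N.
Proof.
apply/matrixP => i j; rewrite mxE; apply: cvg_lim => //.
apply: (@cvg_near_cst _ _ _ _ _); near=> n.
have -> : n = n.-1.+1 by rewrite prednK//; near: n; exact: nbhs_infty_gt.
rewrite /pseries /series/= big_nat_recl//= big1 ?addr0.
  by rewrite /expcoef/= fact0 invr1 mul1r expr0 mulr1.
by move=> k _; rewrite expr0n/= mulr0.
Unshelve. all: by end_near. Qed.

Lemma expser_cvg (t : R) c : geo_bounded c ->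
  (fun N : nat => \sum_(k < N) (k`!%:R)^-1 *: (t ^+ k *: c k)) @ \oo -->
  expser c t.
Proof.
move=> [C [K [C0 K0 h]]]; apply/mx_cvgP => i j; rewrite mxE.
have [cu _] := expser_bound t i j C0 K0 h.
rewrite (_ : (fun N => _) = pseries (expcoef c i j) t)//.
apply/funext => n; rewrite summxE /pseries /series /= big_mkord.
by apply: eq_bigr => k _; rewrite !mxE /expcoef; ring.
Qed.

Lemma expser_linear (L : {linear M -> M}) c (t : R) : geo_bounded c ->
  expser (L \o c) t = L (expser c t).
Proof.
move=> gc; have [CL CL0 hL] := linear_bounded L.
have gLc : geo_bounded (L \o c).
  have [C [K [C0 K0 h]]] := gc; exists (CL * C), K; split=> //.
    exact: mulr_ge0.
  by move=> k /=; rewrite (le_trans (hL _))// -mulrA ler_wpM2l.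
rewrite -(cvg_lim (@norm_hausdorff _ _) (@expser_cvg t _ gLc)).
apply: cvg_lim; first exact: norm_hausdorff.
apply/cvgrPdist_le => e e0.
have e'0 : 0 < e / (CL + 1) by rewrite divr_gt0// ltr_wpDl.
have /cvgrPdist_le/(_ _ e'0) := @expser_cvg t _ gc.
apply: filterS => n /= hn.
rewrite (_ : \sum_(k < n) _ = L (\sum_(k < n) (k`!%:R)^-1 *: (t ^+ k *: c k))).
  rewrite -linearB (le_trans (hL _))//.
  rewrite (le_trans (ler_wpM2l CL0 hn))// mulrCA ler_piMr ?(ltW e0)//.
  by rewrite ler_pdivrMr ?mul1r ?lerDl// ltr_wpDl.
by rewrite linear_sum/=; apply: eq_bigr => k _; rewrite (linearZZ L) (linearZZ L).
Qed.

Lemma geo_bounded_iter (L : {linear M -> M}) V : geo_bounded (fun k => iter k L V).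
Proof.
have [C C0 hL] := linear_bounded L.
exists `|V|, C; split=> // k; elim: k => [|k IH] /=; first by rewrite expr0 mulr1.
by rewrite (le_trans (hL _))// exprS mulrCA ler_wpM2l.
Qed.

Definition opflow (L : {linear M -> M}) V (t : R) := expser (fun k => iter k L V) t.

Lemma is_derive_opflow (L : {linear M -> M}) V (t : R) :
  is_derive t 1 (opflow L V) (L (opflow L V t)).
Proof.
rewrite -expser_linear; last exact: geo_bounded_iter.
exact: is_derive_expser (geo_bounded_iter L V).
Qed.

Lemma opflow0 (L : {linear M -> M}) V : opflow L V 0 = V.
Proof. by rewrite /opflow expser0. Qed.

Lemma opexp_opflow (L : {linear M -> M}) V (t : R) :
  opexp (fun W => t *: L W) V = opflow L V t.
Proof.
apply: cvg_lim => //.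
rewrite (_ : (fun N => _) = (fun N : nat =>
    \sum_(k < N) (k`!%:R)^-1 *: (t ^+ k *: iter k L V))).
  exact: expser_cvg (geo_bounded_iter L V).
apply/funext => n; apply: eq_bigr => k _; congr (_ *: _).
elim: (nat_of_ord k) => [|m IH] /=; first by rewrite expr0 scale1r.
by rewrite IH linearZ/= scalerA exprS.
Qed.

Lemma expm_opflow A (t : R) : expm (t *: A) = opflow (mulmx A) 1%:M t.
Proof.
rewrite -opexp_opflow /expm /opexp; 
rewrite (_ : (fun N : nat => \sum_(k < N) k`!%:R^-1 *: mxpow (t *: A) k) =
  (fun N : nat => \sum_(k < N) k`!%:R^-1 *: iter k (fun W => t *: (A *m W)) 1%:M))//.
apply/funext => n; apply: eq_bigr => k _; congr (_ *: _).
rewrite /mxpow; elim: (nat_of_ord k) => [//|m IH] /=.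
by rewrite IH -scalemxAl.
Qed.

Lemma is_derive_expm A (t : R) :
  is_derive t 1 (fun s : R => expm (s *: A)) (A *m expm (t *: A)).
Proof.
under [X in is_derive _ _ X _]eq_fun do rewrite expm_opflow.
by rewrite expm_opflow; exact: is_derive_opflow.
Qed.

Lemma expm0 : expm (0 : M) = 1%:M.
Proof. by rewrite -(scale0r (0 : M)) expm_opflow opflow0. Qed.

Lemma norm_expm X : `|expm X| <= expR (d%:R * `|X|).
Proof.
rewrite -[in expm X](scale1r X) expm_opflow.
have -> : expR (d%:R * `|X|) = 1 * expR (d%:R * `|X| * `|1 : R|).
  by rewrite normr1 mul1r mulr1.
apply: expser_norm => [//||k]; first by rewrite mulr_ge0.
rewrite mul1r; elim: k => [|k IH] /=; first by rewrite expr0 mx_norm1.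
by rewrite (le_trans (mx_norm_mul _ _))// exprS ler_wpM2l// mulr_ge0.
Qed.

End ExponentialSeries.

(** * The exponential and its Jacobian *)

Lemma mulmxZl {R : comNzRingType} {m n p} (a : R) (A : 'M[R]_(m, n)) (B : 'M[R]_(n, p)) :
  (a *: A) *m B = a *: (A *m B).
Proof. by rewrite scalemxAl. Qed.

Lemma mulmxZr {R : comNzRingType} {m n p} (a : R) (A : 'M[R]_(m, n)) (B : 'M[R]_(n, p)) :
  A *m (a *: B) = a *: (A *m B).
Proof. by rewrite scalemxAr. Qed.

Ltac mxexp := rewrite ?(mulmxDl, mulmxDr, mulmxBl, mulmxBr, mulmxN, mulNmx,
  mulmx0, mul0mx, mulmx1, mul1mx, mulmxA, mulmxZl, mulmxZr).

Section EntryLemmas.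
Context {R : realType} {m n : nat}.
Implicit Types A B : 'M[R]_(m, n).

Lemma mx_addE A B i j : (A + B) i j = A i j + B i j. Proof. by rewrite mxE. Qed.
Lemma mx_oppE A i j : (- A) i j = - A i j. Proof. by rewrite mxE. Qed.
Lemma mx_scaleE (a : R) A i j : (a *: A) i j = a * A i j. Proof. by rewrite mxE. Qed.
Lemma mx_zeroE i j : (0 : 'M[R]_(m, n)) i j = 0. Proof. by rewrite mxE. Qed.
Definition mx_linE := (mx_addE, mx_oppE, mx_scaleE, mx_zeroE).

End EntryLemmas.

(* Atoms are generalized because [rewrite] and [ring] compare them up to
   conversion, which unfolds [expm]. *)
Ltac mxatom := repeat match goal with |- context [@expm ?R ?d ?A] =>
    move: (@expm R d A) => ? end.

(** Once products are expanded, the identities hold in an abelian group: products become opaque and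
    [ring] decides each entry. *)
Ltac mxabel := let i := fresh "i" in let j := fresh "j" in
  mxatom;
  repeat match goal with |- context [@mulmx ?R ?m ?n ?p ?A ?B] =>
    move: (@mulmx R m n p A B) => ? end;
  apply/matrixP => i j; rewrite !mx_linE; ring.

Section Exponential.
Context {R : realType} {d : nat}.
Local Notation M := 'M[R]_d.
Implicit Types (A B X V W : M).

Lemma expm_comm X (t : R) : expm (t *: X) *m X = X *m expm (t *: X).
Proof.
rewrite expm_opflow -(@expser_linear _ _ (mulmx X)); last exact: geo_bounded_iter.
rewrite -[LHS](@expser_linear _ _ (mulmxr X)); last exact: geo_bounded_iter.
congr (expser _ t); apply/funext => k /=.
elim: k => [|k IH] /=; first by rewrite mulmx1 mul1mx.
by rewrite -mulmxA IH.
Qed.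

Lemma is_derive_expmr X (t : R) :
  is_derive t 1 (fun s : R => expm (s *: X)) (expm (t *: X) *m X).
Proof. by rewrite expm_comm; exact: is_derive_expm. Qed.

Lemma expmNscale X (t : R) : expm (t *: - X) *m expm (t *: X) = 1%:M.
Proof.
have h (s : R) : is_derive s 1 (fun s : R => expm (s *: - X) *m expm (s *: X)) 0.
  have := is_derive_mulmx (is_derive_expmr (- X) s) (is_derive_expm X s).
  by move/is_derive_eq; apply; mxexp; rewrite addNr.
by rewrite (is_derive_mx0_cst h t 0) !scale0r expm0 mulmx1.
Qed.

Lemma expmN X : expm (- X) *m expm X = 1%:M.
Proof. by have := expmNscale X 1; rewrite !scale1r. Qed.

Lemma expmNr X : expm X *m expm (- X) = 1%:M.
Proof. by have := expmN (- X); rewrite opprK. Qed.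

Lemma expm_unit X : expm X \in unitmx.
Proof. by have /mulmx1_unit[] := expmN X. Qed.

Lemma invmx_expm X : invmx (expm X) = expm (- X).
Proof.
by rewrite -[LHS]mul1mx -(expmN X) -mulmxA mulmxV ?expm_unit// mulmx1.
Qed.

(** Conjugation by e^{sX} is the integrating factor of phi' = phi X - X phi + w; uniqueness and
    bounds for this equation both come from it. *)
Lemma is_derive_conj_ode X (phi w : R -> M) (t : R) :
  is_derive t 1 phi (phi t *m X - X *m phi t + w t) ->
  is_derive t 1 (fun s : R => expm (s *: X) *m phi s *m expm (s *: - X))
    (expm (t *: X) *m w t *m expm (t *: - X)).
Proof.
move=> dphi.
have := is_derive_mulmx (is_derive_mulmx (is_derive_expmr X t) dphi)
  (is_derive_expm (- X) t).
move/is_derive_eq; apply; mxexp.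
by mxabel.
Qed.

Lemma conj_ode_unique X (phi psi w : R -> M) :
  (forall t : R, is_derive t 1 phi (phi t *m X - X *m phi t + w t)) ->
  (forall t : R, is_derive t 1 psi (psi t *m X - X *m psi t + w t)) ->
  phi 0 = psi 0 -> forall t, phi t = psi t.
Proof.
move=> dphi dpsi h0 t; apply/eqP; rewrite -subr_eq0; apply/eqP.
have ddel (s : R) : is_derive s 1 (fun s : R =>
    expm (s *: X) *m (phi s - psi s) *m expm (s *: - X)) 0.
  have dd : is_derive s 1 (fun s : R => phi s - psi s) ((phi s - psi s) *m X -
      X *m (phi s - psi s) + 0).
    have := is_deriveB (dphi s) (dpsi s); move/is_derive_eq; apply; mxexp.
    by mxabel.
  have := @is_derive_conj_ode X (fun s => phi s - psi s) (fun=> 0) s dd.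
  by rewrite mulmx0 mul0mx.
have := is_derive_mx0_cst ddel t 0; rewrite h0 subrr mulmx0 mul0mx => h.
rewrite -[LHS]mul1mx -[LHS]mulmx1 -(expmNscale X t).
have -> : expm (t *: - X) *m expm (t *: X) *m (phi t - psi t) *m
   (expm (t *: - X) *m expm (t *: X)) = expm (t *: - X) *m
   (expm (t *: X) *m (phi t - psi t) *m expm (t *: - X)) *m expm (t *: X).
  by rewrite !mulmxA.
by rewrite h mulmx0 mul0mx.
Qed.

(** The operator [- ad X], bundled as a linear map so that [opflow] applies. *)
Definition adN X : {linear M -> M} := mulmxr X \- mulmx X.

Definition conjf X V (s : R) := expm (s *: - X) *m V *m expm (s *: X).

Lemma conjf0 X V : conjf X V 0 = V.
Proof. by rewrite /conjf !scale0r expm0 mul1mx mulmx1. Qed.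

Lemma is_derive_conjf X V (t : R) :
  is_derive t 1 (conjf X V) (conjf X V t *m X - X *m conjf X V t).
Proof.
have dV : is_derive t 1 (fun=> V) (0 : M) by exact: is_derive_cst.
have := is_derive_mulmx (is_derive_mulmx (is_derive_expm (- X) t) dV)
  (is_derive_expmr X t).
move/is_derive_eq; apply; rewrite /conjf; mxexp.
by mxabel.
Qed.

Lemma conjf_ode X (phi : R -> M) :
  (forall t : R, is_derive t 1 phi (phi t *m X - X *m phi t)) ->
  forall t, phi t = conjf X (phi 0) t.
Proof.
move=> dphi; apply: (@conj_ode_unique X phi (conjf X (phi 0)) (fun=> 0)) => /= [t|t|].
- by rewrite addr0.
- by rewrite addr0; exact: is_derive_conjf.
- by rewrite conjf0.
Qed.

(** Both sides solve W' = W X - X W with W(0) = V. *)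
Lemma opexp_conjf X V (s : R) :
  opexp (fun W => - (s *: ad X W)) V = conjf X V s.
Proof.
rewrite (_ : (fun W => _) = fun W => s *: adN X W).
  have dV (t : R) : is_derive t 1 (opflow (adN X) V)
    (opflow (adN X) V t *m X - X *m opflow (adN X) V t).
    exact: is_derive_opflow.
  by rewrite opexp_opflow (conjf_ode dV) opflow0.
by apply/funext => W; rewrite /ad /lie_br -scalerN opprB.
Qed.

(** Coefficients of the integral of e^{-u ad X} V over [0, t]: those of the integrand moved up by
    one index, with zero constant term. *)
Definition Jf_coef X V (k : nat) : M :=
  if k is k'.+1 then iter k' (adN X) V else 0.

Definition Jf X V : R -> M := expser (Jf_coef X V).

Lemma Jf0 X V : Jf X V 0 = 0.
Proof. by rewrite /Jf expser0. Qed.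

Lemma geo_bounded_Jf X V : geo_bounded (Jf_coef X V).
Proof.
have [C [K [C0 K0 h]]] := geo_bounded_iter (adN X) V.
exists C, (K + 1); split=> //; first by rewrite addr_ge0.
case=> [|k] /=; first by rewrite normr0 mulr_ge0// exprn_ge0// addr_ge0.
rewrite (le_trans (h k))// ler_wpM2l//.
rewrite (@le_trans _ _ ((K + 1) ^+ k))//.
  by rewrite lerXn2r// ?nnegrE ?addr_ge0// lerDl.
by rewrite exprS ler_peMl ?exprn_ge0 ?addr_ge0// lerDr.
Qed.

Lemma is_derive_Jf X V (t : R) : is_derive t 1 (Jf X V) (conjf X V t).
Proof.
rewrite -opexp_conjf.
rewrite (_ : (fun W => _) = fun W => t *: adN X W); last first.
  by apply/funext => W; rewrite /ad /lie_br -scalerN opprB.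
by rewrite opexp_opflow; apply: is_derive_expser; exact: geo_bounded_Jf.
Qed.

Lemma is_derive_continuous (phi : R -> R) (dphi : R -> R) :
  (forall t : R, is_derive t 1 phi (dphi t)) -> continuous phi.
Proof.
by move=> h t; apply/differentiable_continuous/derivable1_diffP; have [] := h t.
Qed.

(** This removes the Lebesgue integral for good. Any primitive may be used, which is how explicit
    values of the Jacobian are found later. *)
Lemma Jexp_primitive X V (Phi : R -> M) :
  (forall t : R, is_derive t 1 Phi (conjf X V t)) ->
  Jexp X V = Phi 1 - Phi 0.
Proof.
move=> dPhi; apply/matrixP => i j; rewrite !mxE /Rintegral.
under eq_integral do rewrite opexp_conjf.
have dPhiij (t : R) : is_derive t 1 (fun s => Phi s i j) (conjf X V t i j).
  by have /is_derive_mxP := dPhi t.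
have cPhi := is_derive_continuous dPhiij.
rewrite (@continuous_FTC2 _ _ (fun s => Phi s i j))//.
- apply: continuous_subspaceT => x.
  apply: (@is_derive_continuous _
    (fun t => (conjf X V t *m X - X *m conjf X V t) i j)) => t.
  by have /is_derive_mxP := is_derive_conjf X V t.
- split=> [x _||]; first by have [] := dPhiij x.
    by apply: cvg_at_right_filter; exact: cPhi.
  by apply: cvg_at_left_filter; exact: cPhi.
- by move=> x _; rewrite derive1E; have [_ ->] := dPhiij x.
Qed.

Lemma JexpE X V : Jexp X V = Jf X V 1.
Proof. by rewrite (Jexp_primitive (is_derive_Jf X V)) Jf0 subr0. Qed.

Lemma Jexp0 V : Jexp 0 V = V.
Proof.
have dV (s : R) : is_derive s 1 (fun s : R => s *: V) (conjf 0 V s).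
  rewrite /conjf oppr0 !scaler0 expm0 mulmx1 mul1mx.
  exact: is_derive_scale.
by rewrite (Jexp_primitive dV) scale1r scale0r subr0.
Qed.

Lemma Jf_unique X V (Phi : R -> M) :
  (forall t : R, is_derive t 1 Phi (conjf X V t)) -> Phi 0 = 0 ->
  forall t, Phi t = Jf X V t.
Proof.
move=> dPhi h0 t; apply/eqP; rewrite -subr_eq0; apply/eqP.
have h (s : R) : is_derive s 1 (fun s => Phi s - Jf X V s) 0.
  have := is_deriveB (dPhi s) (is_derive_Jf X V s).
  by move/is_derive_eq; apply; rewrite subrr.
by rewrite (is_derive_mx0_cst h t 0) h0 Jf0 subrr.
Qed.

Lemma Jf_linear X (a : R) V W t : Jf X (a *: V + W) t = a *: Jf X V t + Jf X W t.
Proof.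
apply/esym; apply: (@Jf_unique X _ (fun t => a *: Jf X V t + Jf X W t)) => [s|].
  have := is_deriveD (is_deriveZ a (is_derive_Jf X V s)) (is_derive_Jf X W s).
  by move/is_derive_eq; apply; rewrite /conjf; mxexp.
by rewrite !Jf0 scaler0 addr0.
Qed.

Fact Jexp_is_linear X : linear (Jexp X).
Proof. by move=> a V W; rewrite !JexpE Jf_linear. Qed.

HB.instance Definition _ X :=
  GRing.isLinear.Build R M M *:%R (Jexp X) (Jexp_is_linear X).

Lemma is_derive_reparam (phi : R -> M) (a b t : R) V :
  is_derive (a + b * t) 1 phi V ->
  is_derive t 1 (fun s => phi (a + b * s)) (b *: V).
Proof.
move=> dphi; apply/is_derive_mxP => i j; rewrite mxE mulrC.
have /is_derive_mxP/(_ i j) dJ := dphi.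
apply: (@is_derive1_comp _ (fun x => phi x i j) (fun s => a + b * s)) => //.
have := is_deriveD (@is_derive_cst R R R a t 1) (is_deriveZ b (is_derive_id t 1)).
by move/is_derive_eq; apply; rewrite add0r [LHS]mulr1.
Qed.

Lemma expmD X (s t : R) : expm ((s + t) *: X) = expm (s *: X) *m expm (t *: X).
Proof.
have h (x : R) : is_derive x 1 (fun x : R => expm (x *: - X) *m
    expm ((t + 1 * x) *: X)) 0.
  have d2 : is_derive x 1 (fun x : R => expm ((t + 1 * x) *: X))
      (X *m expm ((t + 1 * x) *: X)).
    rewrite -[X in is_derive _ _ _ X]scale1r.
    exact: (is_derive_reparam (is_derive_expm X _)).
  have := is_derive_mulmx (is_derive_expmr (- X) x) d2.
  by move/is_derive_eq; apply; mxexp; rewrite addNr.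
have := is_derive_mx0_cst h s 0.
rewrite mul1r mulr0 addr0 scale0r expm0 mul1mx => <-.
by rewrite mulmxA scalerN expmNr mul1mx addrC.
Qed.

(* [J_{tX} V = t^-1 \int_0^t e^{-s ad X} V ds] without the division *)
Lemma Jexp_scale X V (t : R) : t *: Jexp (t *: X) V = Jf X V t.
Proof.
have dQ (s : R) : is_derive s 1
    (fun s => t *: Jf (t *: X) V s - Jf X V (t * s)) 0.
  have := @is_derive_reparam _ 0 t s _ (is_derive_Jf X V _).
  under [X in is_derive _ _ X _]eq_fun do rewrite add0r.
  move=> /(is_deriveB (is_deriveZ t (is_derive_Jf (t *: X) V s))).
  move/is_derive_eq; apply; rewrite add0r /conjf !scalerN !scalerA.
  by rewrite [s * t]mulrC subrr.
have := is_derive_mx0_cst dQ 1 0.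
rewrite mulr1 mulr0 !Jf0 scaler0 subrr -JexpE => /eqP.
by rewrite subr_eq0 => /eqP.
Qed.
End Exponential.

(** * Lipschitz and differentiability estimates for the exponential *)

Section ExponentialEstimates.
Context {R : realType} {d : nat}.
Local Notation M := 'M[R]_d.
Implicit Types (A B X Y V W : M).

Lemma mx_norm_mul3 A B X :
  `|A *m B *m X| <= (d%:R * d%:R) * (`|A| * `|B| * `|X|).
Proof.
rewrite (le_trans (mx_norm_mul _ _))//.
rewrite [leRHS](_ : _ = d%:R * (d%:R * `|A| * `|B|) * `|X|); last by ring.
by rewrite ler_wpM2r// ler_wpM2l// mx_norm_mul.
Qed.

Lemma expm_ball_bound (rho s : R) X : 0 <= s <= 1 -> `|X| <= rho ->
  `|expm (s *: X)| <= expR (d%:R * rho).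
Proof.
move=> /andP[s0 s1] Xr; rewrite (le_trans (norm_expm _))// ler_expR.
rewrite ler_wpM2l// normrZ ger0_norm// (le_trans _ Xr)//.
by rewrite ler_piMl.
Qed.

(** The product e^{-sX} e^{sY} starts at 1 and has derivative e^{-sX} (Y - X) e^{sY}. *)
Lemma expm_duhamel (rho s : R) X Y : 0 <= s <= 1 -> `|X| <= rho -> `|Y| <= rho ->
  `|expm (s *: - X) *m expm (s *: Y) - 1%:M| <=
  (d%:R * d%:R) * expR (d%:R * rho) ^+ 2 * `|Y - X|.
Proof.
move=> /andP[s0 s1] Xr Yr.
set phi := fun s : R => expm (s *: - X) *m expm (s *: Y).
have dphi (t : R) : is_derive t 1 phi
    (expm (t *: - X) *m (Y - X) *m expm (t *: Y)).
  have := is_derive_mulmx (is_derive_expmr (- X) t) (is_derive_expm Y t).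
  move/is_derive_eq; apply; mxexp.
  by mxabel.
have b0 : 0 <= (d%:R * d%:R) * expR (d%:R * rho) ^+ 2 * `|Y - X|.
  by rewrite !mulr_ge0// exprn_ge0// expR_ge0.
have := mx_MVT_le s0 b0 (fun t _ => dphi t).
rewrite {2}/phi !scale0r expm0 mul1mx subr0 => h.
have {}h := h _; rewrite (le_trans (h _))// => [t /andP[t0 ts]|]; last first.
  by rewrite ler_piMr.
have t1 : 0 <= t <= 1 by rewrite t0 (le_trans ts s1).
rewrite (le_trans (mx_norm_mul3 _ _ _))// -[leRHS]mulrA ler_wpM2l ?mulr_ge0//.
rewrite mulrAC ler_wpM2r// expr2 ler_pM// expm_ball_bound ?normrN//.
Qed.

Lemma expm_lipschitz (rho : R) : exists2 C : R, 0 <= C &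
  forall (s : R) X Y, 0 <= s <= 1 -> `|X| <= rho -> `|Y| <= rho ->
    `|expm (s *: Y) - expm (s *: X)| <= C * `|Y - X|.
Proof.
set b := expR (d%:R * rho).
exists (d%:R * b * ((d%:R * d%:R) * b ^+ 2)).
  by rewrite !mulr_ge0// ?exprn_ge0// expR_ge0.
move=> s X Y s01 Xr Yr.
have -> : expm (s *: Y) - expm (s *: X) =
    expm (s *: X) *m (expm (s *: - X) *m expm (s *: Y) - 1%:M).
  by rewrite mulmxBr mulmx1 mulmxA scalerN expmNr mul1mx.
rewrite (le_trans (mx_norm_mul _ _))// -[leRHS]mulrA ler_pM//.
- by rewrite ler_wpM2l// expm_ball_bound.
- exact: expm_duhamel.
Qed.

(* Duhamel: [e^P - e^Q - e^S J(S) H] is the integral over [0, 1] of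
   [e^((1-s)Q) H e^(sP) - e^((1-s)S) H e^(sS)] with [H = P - Q] *)
Lemma expm_strict_diff (rho : R) : exists2 C : R, 0 <= C &
  forall S P Q : M, `|S| <= rho -> `|P| <= rho -> `|Q| <= rho ->
    `|expm P - expm Q - expm S *m Jexp S (P - Q)| <=
    C * (`|P - S| + `|Q - S|) * `|P - Q|.
Proof.
set b := expR (d%:R * rho).
have b0 : 0 <= b by exact: expR_ge0.
have [CL CL0 hL] := expm_lipschitz rho.
have dd0 : 0 <= (d%:R * d%:R : R) by rewrite mulr_ge0.
exists ((d%:R * d%:R) * b * (CL + CL)); first by rewrite !mulr_ge0// addr_ge0.
move=> S P Q Sr Pr Qr; set H := P - Q.
set phi := fun s : R => expm Q *m (expm (s *: - Q) *m expm (s *: P)) -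
  expm S *m Jf S H s.
have eQ (t : R) X : expm X *m expm (t *: - X) = expm ((1 - t) *: X).
  by rewrite expmD scale1r scaleNr scalerN.
have dphi (t : R) : is_derive t 1 phi
   (expm ((1 - t) *: Q) *m H *m expm (t *: P) -
    expm ((1 - t) *: S) *m H *m expm (t *: S)).
  have d1 := is_derive_mulmx (is_derive_expmr (- Q) t) (is_derive_expm P t).
  have d2 := is_deriveB (is_derive_lin (mulmx (expm Q)) d1)
    (is_derive_lin (mulmx (expm S)) (is_derive_Jf S H t)).
  move: d2 => /is_derive_eq; apply; rewrite -!eQ /conjf /H /=.
  by mxatom; mxexp; mxabel.
have bd0 : 0 <= (d%:R * d%:R) * b * (CL + CL) * (`|P - S| + `|Q - S|) * `|H|.
  by rewrite !mulr_ge0// addr_ge0.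
have := mx_MVT_le (@ler01 R) bd0 (fun t _ => dphi t).
rewrite {1}/phi {1}/phi !scale1r -JexpE !scale0r expm0 Jf0 mulmx0 subr0 !mulmx1.
rewrite mulmxA expmNr mul1mx subr0 mulr1 => h.
rewrite -[X in `|X|](_ : expm P - expm S *m Jexp S H - expm Q = _); last first.
  by rewrite addrAC.
apply: h => t /andP[t0 t1].
have t01 : 0 <= t <= 1 by rewrite t0.
have t01' : 0 <= 1 - t <= 1 by rewrite subr_ge0 t1 lerBlDr lerDl.
have -> : expm ((1 - t) *: Q) *m H *m expm (t *: P) -
    expm ((1 - t) *: S) *m H *m expm (t *: S) =
    (expm ((1 - t) *: Q) - expm ((1 - t) *: S)) *m H *m expm (t *: P) +
    expm ((1 - t) *: S) *m H *m (expm (t *: P) - expm (t *: S)).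
  by mxatom; move: (H) => W; mxexp; mxabel.
rewrite (le_trans (ler_normD _ _))//.
rewrite [leRHS](_ : _ = d%:R * d%:R * ((CL * `|Q - S|) * `|H| * b) +
    d%:R * d%:R * (b * `|H| * (CL * `|P - S|)) +
    d%:R * d%:R * b * CL * `|H| * (`|P - S| + `|Q - S|)); last by ring.
rewrite -[leLHS]addr0 lerD//; last by rewrite !mulr_ge0// addr_ge0.
apply: lerD; rewrite (le_trans (mx_norm_mul3 _ _ _))// ler_wpM2l//.
  by rewrite ler_pM ?ler_wpM2r ?mulr_ge0 ?hL ?expm_ball_bound.
by rewrite ler_pM ?ler_wpM2r ?mulr_ge0 ?hL ?expm_ball_bound.
Qed.

(** Chain rule relative to a set [P] of increments: for X |-> J_X (D X) the Fréchet estimate is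
    available only for increments in the Lie algebra. *)
Lemma is_derive_frechet (P : set M) (F : M -> M) (L : {linear M -> M})
    (X : R -> M) (t : R) V :
  (forall s, P (X s - X t)) ->
  (forall e : R, 0 < e -> exists2 del : R, 0 < del & forall W, P W -> `|W| < del ->
    `|F (X t + W) - F (X t) - L W| <= e * `|W|) ->
  is_derive t 1 X V -> is_derive t 1 (fun s => F (X s)) (L V).
Proof.
move=> hP hF /is_derive_dist_le dX; apply/is_derive_dist_le => e e0.
have [CL CL0 hL] := linear_bounded L.
have V1 : 0 < `|V| + 1 by rewrite ltr_wpDl.
have e1 : 0 < e / 2 / (`|V| + 1) by rewrite !divr_gt0.
have [del1 del10 h1] := hF _ e1.
have e2 : 0 < Num.min 1 (e / 2 / (CL + 1)).
  by rewrite lt_min ltr01 !divr_gt0// ltr_wpDl.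
have [del2 del20 h2] := dX _ e2.
exists (Num.min del2 (del1 / (`|V| + 1))); first by rewrite lt_min del20 divr_gt0.
move=> h; rewrite lt_min => /andP[hd2 hd1].
have {}h2 := h2 h hd2; set W := X (t + h) - X t.
have Wle : `|W| <= (`|V| + 1) * `|h|.
  rewrite -(subrK (h *: V) W) (le_trans (ler_normD _ _))// normrZ.
  rewrite mulrDl addrC mulrC lerD2l (le_trans h2)// ler_wpM2r//.
  by rewrite ge_min lexx.
have Wdel : `|W| < del1.
  by rewrite (le_lt_trans Wle)// mulrC -ltr_pdivlMr.
have := h1 W (hP _) Wdel; rewrite {1}/W addrCA subrr addr0 => h3.
rewrite -(subrK (L W) (F (X (t + h)) - F (X t))) -addrA.
rewrite (le_trans (ler_normD _ _))// (splitr e) mulrDl lerD//.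
  rewrite (le_trans h3)// (le_trans (ler_wpM2l (ltW e1) Wle))//.
  by rewrite mulrA divfK// gt_eqF.
rewrite -linearZZ -linearB (le_trans (hL _))//.
rewrite (le_trans (ler_wpM2l CL0 h2))// mulrA ler_wpM2r//.
rewrite (@le_trans _ _ (CL * (e / 2 / (CL + 1))))//.
  by rewrite ler_wpM2l// ge_min lexx orbT.
rewrite mulrCA ler_piMr ?divr_ge0 ?(ltW e0)//.
by rewrite ler_pdivrMr ?mul1r ?lerDl// ltr_wpDl.
Qed.

Lemma expm_frechet X (e : R) : 0 < e -> exists2 del : R, 0 < del & forall W, `|W| < del ->
  `|expm (X + W) - expm X - expm X *m Jexp X W| <= e * `|W|.
Proof.
move=> e0; have [C C0 hC] := expm_strict_diff (`|X| + 1).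
exists (Num.min 1 (e / (C + 1))).
  by rewrite lt_min ltr01 divr_gt0// ltr_wpDl.
move=> W; rewrite lt_min => /andP[W1 We].
have := hC X (X + W) X; rewrite [X + W - X]addrAC subrr add0r normr0 addr0.
move=> /(_ _ _ _)/le_trans; apply; rewrite ?lerDl//.
  by rewrite (le_trans (ler_normD _ _))// lerD2l ltW.
rewrite ler_wpM2r//; move: We; rewrite ltr_pdivlMr ?ltr_wpDl// => /ltW; apply: le_trans.
by rewrite mulrDr mulr1 mulrC lerDl.
Qed.

Lemma is_derive_expm_path (X : R -> M) (t : R) V :
  is_derive t 1 X V ->
  is_derive t 1 (fun s => expm (X s)) (expm (X t) *m Jexp (X t) V).
Proof.
move=> dX.
apply: (@is_derive_frechet setT _ (mulmx (expm (X t)) \o Jexp (X t))) dX => // e e0.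
by have [del del0 h] := expm_frechet (X t) e0; exists del => // W _; exact: h.
Qed.

End ExponentialEstimates.

(** * The Lie algebra of a closed subgroup *)

Section LieAlgebra.
Context {R : realType} {d : nat}.
Local Notation M := 'M[R]_d.
Implicit Types (A B X Y V W : M).

Lemma mxpow_norm (g : M) (a : R) k : `|g - 1%:M| <= a ->
  `|mxpow g k| <= (1 + d%:R * a) ^+ k.
Proof.
move=> ga; have a0 : 0 <= a by exact: le_trans ga.
elim: k => [|k IH] /=; first by rewrite expr0 mx_norm1.
rewrite -[g in g *m _](subrK 1%:M) mulmxDl mul1mx addrC.
rewrite (le_trans (ler_normD _ _))// exprS mulrDl mul1r lerD//.
rewrite (le_trans (mx_norm_mul _ _))// ler_pM ?mulr_ge0// ler_wpM2l//.
Qed.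

(** The last factor stays bounded when [a] is of order 1/k, so an error o(1/k) in one step remains
    o(1) after k steps. *)
Lemma mxpow_dist (g h : M) (a : R) k : `|g - 1%:M| <= a -> `|h - 1%:M| <= a ->
  `|mxpow g k - mxpow h k| <= k%:R * (d%:R * `|g - h|) * (1 + d%:R * a) ^+ k.
Proof.
move=> ga ha; have a0 : 0 <= a by exact: le_trans ga.
have c0 : 0 <= 1 + d%:R * a by rewrite addr_ge0// mulr_ge0.
elim: k => [|k IH] /=; first by rewrite subrr normr0 !mul0r.
have -> : g *m mxpow g k - h *m mxpow h k =
    (mxpow g k - mxpow h k) + (g - 1%:M) *m (mxpow g k - mxpow h k) +
    (g - h) *m mxpow h k.
  by mxexp; mxabel.
rewrite (le_trans (ler_normD _ _))//.
rewrite (@le_trans _ _ ((1 + d%:R * a) * `|mxpow g k - mxpow h k| +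
    d%:R * `|g - h| * (1 + d%:R * a) ^+ k))//.
  rewrite lerD//; last first.
    by rewrite (le_trans (mx_norm_mul _ _))// ler_wpM2l ?mulr_ge0// mxpow_norm.
  rewrite (le_trans (ler_normD _ _))// mulrDl mul1r lerD2l.
  by rewrite (le_trans (mx_norm_mul _ _))// ler_wpM2r// ler_wpM2l.
rewrite -natr1 [X in _ <= X * _]mulrDl mul1r [leRHS]mulrDl lerD//.
  by rewrite exprS [leRHS]mulrCA ler_wpM2l.
by rewrite ler_wpM2l ?mulr_ge0// exprS ler_peMl ?exprn_ge0// lerDl mulr_ge0.
Qed.

Lemma mxpow_expm A k : mxpow (expm A) k = expm (k%:R *: A).
Proof.
elim: k => [|k IH] /=; first by rewrite scale0r expm0.
by rewrite IH -natr1 addrC expmD scale1r.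
Qed.

Lemma expm_conj (g : M) X (t : R) : g \in unitmx ->
  expm (t *: (g *m X *m invmx g)) = g *m expm (t *: X) *m invmx g.
Proof.
move=> gu; set Z := g *m X *m invmx g.
have h (s : R) : is_derive s 1
    (fun s : R => expm (s *: - Z) *m (g *m expm (s *: X))) 0.
  have := is_derive_mulmx (is_derive_expmr (- Z) s)
    (is_derive_lin (mulmx g) (is_derive_expm X s)).
  move/is_derive_eq; apply; rewrite /Z /=; mxexp.
  by rewrite (mulmxKV gu) addNr.
have := is_derive_mx0_cst h t 0; rewrite !scale0r expm0 mulmx1 mul1mx => E.
rewrite -[LHS]mulmx1 -(mulmxV gu) -{1}E !mulmxA scalerN expmNr mul1mx.
by [].
Qed.

Context (G : set M) (HG : closed_subgroup_GL G).

Lemma group1 : G 1%:M. Proof. by case: HG. Qed.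

Lemma groupM g h : G g -> G h -> G (g *m h). Proof. by case: HG => _ + _ _; apply. Qed.

Lemma groupV g : G g -> G (invmx g). Proof. by case: HG => _ _ + _ Gg => /(_ _ Gg)[]. Qed.

Lemma group_unit g : G g -> g \in unitmx.
Proof. by case: HG => _ _ + _ Gg => /(_ _ Gg)[]. Qed.

Lemma group_closed A : A \in unitmx ->
  (forall e : R, 0 < e -> exists2 g, G g & `|A - g| < e) -> G A.
Proof.
case: HG => _ _ _ Gcl Au h; apply: Gcl; split=> //.
move=> B /nbhs_ballP[e /= e0 eB]; have [g Gg Ag] := h e e0.
by exists g; split => //; apply: eB; rewrite -ball_normE.
Qed.

Lemma group_mxpow g k : G g -> G (mxpow g k).
Proof. by move=> Gg; elim: k => [|k IH] /=; [exact: group1|exact: groupM]. Qed.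

Lemma lie_exp X : lie_alg G X -> G (expm X).
Proof. by move=> /(_ 1); rewrite scale1r. Qed.

(* [A] is in the Lie algebra as soon as it is a sequential tangent direction:
   if [g] is close to [1 + rA], then [g ^ (t / r)] is close to [e^(tA)] *)
Lemma lie_tangent A :
  (forall e : R, 0 < e -> exists g, exists r : R,
     [/\ G g, 0 < r, r < e & `|g - 1%:M - r *: A| <= e * r]) -> lie_alg G A.
Proof.
move=> hA.
suff pos (t : R) : 0 < t -> G (expm (t *: A)).
  move=> t; have [t0|t0|->] := ltgtP t 0; [|exact: pos|].
    have := groupV (pos (- t) _); rewrite oppr_gt0 invmx_expm scaleNr opprK.
    by apply.
  by rewrite scale0r expm0; exact: group1.
move=> t0; apply: group_closed (expm_unit _) _ => eta eta0.
set rho := (t + 1) * `|A|.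
have [C1 C10 hC1] := @expm_strict_diff R d rho.
have [CL CL0 hCL] := @expm_lipschitz R d rho.
set a0 := `|A| + 1 + C1 * `|A| ^+ 2.
have a00 : 0 <= a0 by rewrite !addr_ge0// mulr_ge0// exprn_ge0.
set E := expR (d%:R * a0 * t).
(* [e * K] will bound the total error: the first term compares g^m with e^{mrA}, the second e^{mrA}
   with e^{tA}, where m is the integer part of t / r. *)
set K := t * d%:R * E * (1 + C1 * `|A| ^+ 2) + CL * `|A|.
have K0 : 0 <= K.
  by rewrite addr_ge0 ?mulr_ge0 ?expR_ge0 ?addr_ge0 ?mulr_ge0 ?exprn_ge0// ltW.
set e := Num.min 1 (eta / (K + 1)).
have e0 : 0 < e by rewrite lt_min ltr01 divr_gt0// ltr_wpDl.
have e1 : e <= 1 by rewrite ge_min lexx.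
have [g [r [Gg r0 re hg]]] := hA e e0.
have r1 : r <= 1 by rewrite ltW// (lt_le_trans re).
set m := Num.trunc (t / r).
have /andP[m1 m2] : m%:R <= t / r < m.+1%:R.
  by apply: truncn_itv; rewrite divr_ge0// ltW.
have mr : m%:R * r <= t by rewrite -ler_pdivlMr.
have mr' : t - m%:R * r <= r.
  by move: m2; rewrite ltr_pdivrMr// -natr1 mulrDl mul1r lerBlDr addrC => /ltW.
exists (mxpow g m); first exact: group_mxpow.
set h := expm (r *: A).
have rho0 : 0 <= rho by rewrite mulr_ge0// addr_ge0// ltW.
have rArho : `|r *: A| <= rho.
  rewrite normrZ gtr0_norm// ler_wpM2r// (le_trans r1)// lerDr ltW//.
have hh : `|h - 1%:M - r *: A| <= C1 * `|A| ^+ 2 * r ^+ 2.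
  have := hC1 0 (r *: A) 0; rewrite !subr0 normr0 addr0 expm0 mul1mx.
  rewrite Jexp0.
  move=> /(_ rho0 rArho rho0)/le_trans; apply; rewrite normrZ gtr0_norm//.
  by rewrite le_eqVlt; apply/orP; left; apply/eqP; ring.
have g1 : `|g - 1%:M| <= r * a0.
  rewrite -(subrK (r *: A) (g - 1%:M)) (le_trans (ler_normD _ _))//.
  rewrite normrZ gtr0_norm// /a0 !mulrDr mulr1.
  rewrite -[leLHS]addr0 lerD ?mulr_ge0 ?exprn_ge0 ?(ltW r0)//.
  rewrite addrC lerD2l (le_trans hg)// ler_piMl// ltW//.
have h1 : `|h - 1%:M| <= r * a0.
  rewrite -(subrK (r *: A) (h - 1%:M)) (le_trans (ler_normD _ _))//.
  rewrite normrZ gtr0_norm// /a0 [leLHS]addrC !mulrDr mulr1 -[leRHS]addrA lerD2l.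
  rewrite (le_trans hh)// -[leLHS]add0r lerD ?(ltW r0)//.
  by rewrite mulrC ler_wpM2r ?mulr_ge0 ?exprn_ge0// expr2 ler_piMl// ltW.
have := mxpow_dist m g1 h1; rewrite {2}/h mxpow_expm scalerA => hm.
have cE : (1 + d%:R * (r * a0)) ^+ m <= E.
  rewrite (@le_trans _ _ (expR (d%:R * (r * a0)) ^+ m))//.
    rewrite lerXn2r ?nnegrE ?expR_ge0 ?addr_ge0 ?mulr_ge0 ?(ltW r0)//.
    exact: expR_ge1Dx.
  rewrite -expRM_natl ler_expR.
  rewrite [leLHS](_ : _ = d%:R * a0 * (m%:R * r)); last by ring.
  by rewrite ler_wpM2l ?mulr_ge0.
have gh : `|g - h| <= r * (e * (1 + C1 * `|A| ^+ 2)).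
  rewrite (_ : g - h = (g - 1%:M - r *: A) - (h - 1%:M - r *: A)); last first.
    by mxabel.
  rewrite (le_trans (ler_normB _ _))// mulrDr mulr1 mulrDr lerD//.
    by rewrite mulrC.
  rewrite (le_trans hh)// expr2 mulrA mulrC ler_wpM2l ?(ltW r0)//.
  by rewrite mulrC ler_wpM2r ?mulr_ge0 ?exprn_ge0// ltW.
have {}hm : `|mxpow g m - expm (m%:R * r *: A)| <=
    e * (t * d%:R * E * (1 + C1 * `|A| ^+ 2)).
  rewrite (le_trans hm)//.
  rewrite (@le_trans _ _ (m%:R * (d%:R * (r * (e * (1 + C1 * `|A| ^+ 2)))) * E))//.
    rewrite ler_pM ?mulr_ge0 ?exprn_ge0 ?addr_ge0 ?mulr_ge0 ?(ltW r0)//.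
    by rewrite ler_wpM2l// ler_wpM2l.
  rewrite [leLHS](_ : _ = m%:R * r * (d%:R * E * (e * (1 + C1 * `|A| ^+ 2)))); last by ring.
  rewrite [leRHS](_ : _ = t * (d%:R * E * (e * (1 + C1 * `|A| ^+ 2)))); last by ring.
  by rewrite ler_wpM2r ?mulr_ge0 ?expR_ge0 ?addr_ge0 ?mulr_ge0 ?exprn_ge0 ?(ltW e0).
have ht : `|expm (t *: A) - expm (m%:R * r *: A)| <= e * (CL * `|A|).
  have := hCL 1 (m%:R * r *: A) (t *: A); rewrite !scale1r.
  have mr0 : 0 <= m%:R * r by rewrite mulr_ge0// ltW.
  have mrrho : `|m%:R * r *: A| <= rho.
    by rewrite normrZ ger0_norm// ler_wpM2r// (le_trans mr)// lerDl.
  have trho : `|t *: A| <= rho.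
    by rewrite normrZ gtr0_norm// ler_wpM2r// lerDl.
  move=> /(_ _ mrrho trho); rewrite ler01 lexx => /(_ isT)/le_trans; apply.
  rewrite -scalerBl normrZ ger0_norm ?subr_ge0// mulrCA ler_wpM2r ?mulr_ge0//.
  by rewrite (le_trans mr')// ltW.
rewrite (_ : expm (t *: A) - _ = (expm (t *: A) - expm (m%:R * r *: A)) -
    (mxpow g m - expm (m%:R * r *: A))); last first.
  by rewrite opprB addrA subrK.
rewrite (le_lt_trans (ler_normB _ _))//.
rewrite (@le_lt_trans _ _ (e * K))//.
  by rewrite /K mulrDr addrC lerD.
rewrite (@le_lt_trans _ _ (eta / (K + 1) * K))//.
  by rewrite ler_wpM2r// ge_min lexx orbT.
by rewrite -mulrA gtr_pMr// mulrC ltr_pdivrMr ?mul1r ?ltrDl// ltr_wpDl.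
Qed.

Lemma lie_tangent_path (g : R -> M) A :
  (forall s, G (g s)) -> g 0 = 1%:M -> is_derive (0 : R) 1 g A -> lie_alg G A.
Proof.
move=> Gg g0 /is_derive_dist_le dg; apply: lie_tangent => e e0.
have [del del0 h] := dg e e0.
have m0 : 0 < Num.min del e / 2 by rewrite divr_gt0// lt_min del0.
have m1 : Num.min del e / 2 < Num.min del e.
  by rewrite ltr_pdivrMr// ltr_pMr ?ltr1n// lt_min del0.
exists (g (Num.min del e / 2)), (Num.min del e / 2); split=> //.
  by rewrite (lt_le_trans m1)// ge_min lexx orbT.
have := h (Num.min del e / 2); rewrite gtr0_norm// add0r g0; apply.
by rewrite (lt_le_trans m1)// ge_min lexx.
Qed.

Lemma lie0 : lie_alg G 0.
Proof. by move=> t; rewrite scaler0 expm0; exact: group1. Qed.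

Lemma lieZ (a : R) X : lie_alg G X -> lie_alg G (a *: X).
Proof. by move=> hX t; rewrite scalerA; exact: hX. Qed.

Lemma lieD X Y : lie_alg G X -> lie_alg G Y -> lie_alg G (X + Y).
Proof.
move=> hX hY; apply: (@lie_tangent_path (fun s => expm (s *: X) *m expm (s *: Y))).
- by move=> s; exact: groupM.
- by rewrite !scale0r expm0 mulmx1.
- have := is_derive_mulmx (is_derive_expm X 0) (is_derive_expm Y 0).
  by move/is_derive_eq; apply; rewrite !scale0r expm0 !mulmx1 mul1mx.
Qed.

Lemma lieN X : lie_alg G X -> lie_alg G (- X).
Proof. by rewrite -scaleN1r; exact: lieZ. Qed.

Lemma lieB X Y : lie_alg G X -> lie_alg G Y -> lie_alg G (X - Y).
Proof. by move=> hX hY; apply: lieD => //; exact: lieN. Qed.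

Lemma lie_sum (I : finType) (F : I -> M) :
  (forall i, lie_alg G (F i)) -> lie_alg G (\sum_i F i).
Proof. by move=> hF; apply: big_ind => //; [exact: lie0|exact: lieD]. Qed.

Lemma lie_conj g X : G g -> lie_alg G X -> lie_alg G (g *m X *m invmx g).
Proof.
move=> Gg hX t; have gu := group_unit Gg.
rewrite expm_conj//.
by apply: groupM; [exact: groupM|exact: groupV].
Qed.

(** For X near A and r small, e^{rX} is close to 1 + rA, so A is a tangent direction. Closedness
    keeps derivatives and sums of series in the Lie algebra. *)
Lemma lie_closed A :
  (forall e : R, 0 < e -> exists2 X, lie_alg G X & `|X - A| <= e) -> lie_alg G A.
Proof.
move=> hA; apply: lie_tangent => e e0.
have e2 : 0 < e / 2 by rewrite divr_gt0.
have [X hX XA] := hA (e / 2) e2.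
have /is_derive_dist_le/(_ _ e2)[del del0 h] := is_derive_expm X 0.
have m0 : 0 < Num.min del e / 2 by rewrite divr_gt0// lt_min del0.
have m1 : Num.min del e / 2 < Num.min del e.
  by rewrite ltr_pdivrMr// ltr_pMr ?ltr1n// lt_min del0.
set r := Num.min del e / 2 in m0 m1 *.
exists (expm (r *: X)), r; split=> //.
  by rewrite (lt_le_trans m1)// ge_min lexx orbT.
have := h r; rewrite gtr0_norm// add0r !scale0r expm0 mulmx1 => {}h.
rewrite (_ : _ - _ - _ = (expm (r *: X) - 1%:M - r *: X) + r *: (X - A)); last first.
  by rewrite scalerBr addrA subrK.
rewrite (le_trans (ler_normD _ _))// [e in e * _](splitr e) mulrDl lerD//.
  by apply: h; rewrite (lt_le_trans m1)// ge_min lexx.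
by rewrite normrZ gtr0_norm// mulrC ler_wpM2r// ltW.
Qed.

Lemma lie_derive_near (phi : R -> M) (t r : R) V : 0 < r ->
  (forall h : R, `|h| < r -> lie_alg G (phi (t + h))) ->
  is_derive t 1 phi V -> lie_alg G V.
Proof.
move=> r0 hphi /is_derive_dist_le dphi; apply: lie_closed => e e0.
have [del' del'0 h] := dphi e e0; pose del := Num.min del' r.
have del0 : 0 < del by rewrite lt_min del'0.
have m0 : 0 < del / 2 by rewrite divr_gt0.
have m1 : del / 2 < del by rewrite ltr_pdivrMr// ltr_pMr// ltr1n.
have hphi0 : lie_alg G (phi t) by rewrite -[t]addr0; apply: hphi; rewrite normr0.
exists ((del / 2)^-1 *: (phi (t + del / 2) - phi t)).
  apply: lieZ; apply: lieB hphi0; apply: hphi.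
  by rewrite gtr0_norm// (lt_le_trans m1)// ge_min lexx orbT.
rewrite -(@ler_pM2l _ (del / 2))// -{1}(gtr0_norm m0) -normrZ scalerBr scalerA.
rewrite mulfV ?gt_eqF// scale1r [leRHS]mulrC.
have := h (del / 2); rewrite (gtr0_norm m0); apply.
by rewrite (lt_le_trans m1)// ge_min lexx.
Qed.

Lemma lie_derive (phi : R -> M) (t : R) V :
  (forall s, lie_alg G (phi s)) -> is_derive t 1 phi V -> lie_alg G V.
Proof. by move=> hphi; apply: (@lie_derive_near _ _ 1). Qed.

Lemma lie_conjf X V (s : R) : lie_alg G X -> lie_alg G V -> lie_alg G (conjf X V s).
Proof.
move=> hX hV; rewrite /conjf.
have -> : expm (s *: X) = invmx (expm (s *: - X)).
  by rewrite invmx_expm scalerN opprK.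
by apply: lie_conj => //; rewrite scalerN -scaleNr.
Qed.

(** Up to sign, the bracket is the velocity at 0 of e^{-sX} Y e^{sX}, a curve in the Lie algebra. *)
Lemma lie_bracket X Y : lie_alg G X -> lie_alg G Y -> lie_alg G (lie_br X Y).
Proof.
move=> hX hY; rewrite -[lie_br X Y]opprK; apply: lieN.
have := is_derive_conjf X Y 0; rewrite conjf0 => /lie_derive.
by rewrite /lie_br opprB; apply => s; exact: lie_conjf.
Qed.

Lemma lie_Jf X V (t : R) : lie_alg G X -> lie_alg G V -> lie_alg G (Jf X V t).
Proof.
move=> hX hV; apply: lie_closed => e e0.
have /cvgrPdist_le/(_ _ e0)[N _ hN] := @expser_cvg _ _ t _ (geo_bounded_Jf X V).
exists (\sum_(k < N) (k`!%:R)^-1 *: (t ^+ k *: Jf_coef X V k)).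
  apply: lie_sum => k; do 2 apply: lieZ.
  case: (nat_of_ord k) => [|m] /=; first exact: lie0.
  elim: m => [//|m IH] /=; rewrite -[_ - _]opprB; apply: lieN.
  exact: lie_bracket.
by rewrite distrC; apply: hN => /=.
Qed.

Lemma lie_Jexp X V : lie_alg G X -> lie_alg G V -> lie_alg G (Jexp X V).
Proof. by rewrite JexpE; exact: lie_Jf. Qed.

(** A subspace of maximal dimension inside the Lie algebra exhausts it, since a missing vector could
    be adjoined. This gives a mere set bases and a dimension. *)
Lemma lie_vspace : exists U : {vspace M}, forall X, X \in U <-> lie_alg G X.
Proof.
pose P n := `[< exists U : {vspace M}, (forall X, X \in U -> lie_alg G X) /\ \dim U = n >].
have exP : exists n, P n.
  exists 0%N; apply/asboolP; exists 0%VS; split; last exact: dimv0.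
  by move=> X; rewrite memv0 => /eqP ->; exact: lie0.
have ubP n : P n -> (n <= \dim {:M})%N.
  by move=> /asboolP[U [_ <-]]; exact/dimvS/subvf.
case: (ex_maxnP exP ubP) => n /asboolP[U [hU dimU]] hmax.
exists U => X; split; first exact: hU.
move=> hX; apply: contrapT => /negP XU.
have : P (\dim (U + <[X]>)%VS).
  apply/asboolP; exists (U + <[X]>)%VS; split=> // Y /memv_addP[A AU [B BX ->]].
  apply: lieD; first exact: hU.
  by move: BX => /vlineP[k ->]; exact: lieZ.
move=> /hmax; rewrite -dimU => dle.
have : (U + <[X]> == U)%VS by rewrite eq_sym eqEdim dle addvSl.
by move/eqP/addv_idPl; rewrite -memvE (negbTE XU).
Qed.

(** Coordinates in a basis of the Lie algebra are linear forms on all matrices. The extension is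
    bounded and commutes with derivatives, neither of which makes sense for a map constrained only
    on a subset. *)
Lemma lie_linear_extension (D : M -> M) :
  (forall (a : R) X Y, lie_alg G X -> lie_alg G Y -> D (a *: X + Y) = a *: D X + D Y) ->
  exists L : {linear M -> M}, forall X, lie_alg G X -> D X = L X.
Proof.
move=> Dlin; have [U hU] := lie_vspace.
have b i : lie_alg G (vbasis U)`_i.
  have [iU|Ui] := ltnP i (size (vbasis U)); first by apply/hU/vbasis_mem/mem_nth.
  by rewrite nth_default//; exact: lie0.
have D0 : D 0 = 0.
  have := Dlin (-1) 0 0 lie0 lie0; rewrite scaler0 addr0 scaleN1r => ->.
  by rewrite addNr.
pose L V := \sum_i coord (vbasis U) i V *: D (vbasis U)`_i.
have Llin : linear L.
  move=> a V W; rewrite /L scaler_sumr -big_split; apply: eq_bigr => i _ /=.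
  by rewrite linearP scalerDl scalerA.
pose L' : {linear M -> M} := HB.pack L (GRing.isLinear.Build R M M *:%R L Llin).
exists L' => X /hU XU; rewrite /= /L {1}(coord_vbasis XU).
have Dsum (s : seq 'I_(\dim U)) (F : 'I_(\dim U) -> R) :
    lie_alg G (\sum_(i <- s) F i *: (vbasis U)`_i) /\
    D (\sum_(i <- s) F i *: (vbasis U)`_i) = \sum_(i <- s) F i *: D (vbasis U)`_i.
  elim: s => [|i s [IH1 IH2]]; first by rewrite !big_nil; split=> //; exact: lie0.
  rewrite !big_cons Dlin// IH2; split=> //.
  by apply: lieD => //; exact: lieZ.
by have [_] := Dsum (index_enum _) (fun i => coord (vbasis U) i X).
Qed.

End LieAlgebra.

(** * Local surjectivity of the exponential *)

Lemma continuous_dist_le {R : realType} {V W : normedModType R} (f : V -> W) :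
  (forall x (e : R), 0 < e -> exists2 del : R, 0 < del &
     forall y, `|x - y| < del -> `|f x - f y| <= e) -> continuous f.
Proof.
move=> h x; apply/cvgrPdist_le => /= e e0; have [del del0 hd] := h x e e0.
near=> y; apply: hd; near: y; exact: cvgr_dist_lt.
Unshelve. all: by end_near. Qed.

Section MatrixCompact.
Context {R : realType} {d : nat}.
Local Notation M := 'M[R]_d.

Lemma vec_mx_continuous : continuous (vec_mx : 'rV[R]_(d * d) -> M).
Proof.
apply: (@continuous_dist_le R 'rV[R]_(d * d) M) => v e e0; exists e => // w vw.
apply/mx_norm_leP => [|i j]; first exact: ltW.
move: (ltW vw); rewrite {1}/Num.Def.normr/= mx_normrE.
move=> /bigmax_leP[_ /(_ (0, mxvec_index i j) isT)].
by rewrite !mxE.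
Qed.

(** The Heine-Borel theorem for row vectors, transported by [vec_mx]. *)
Lemma mx_closed_ball_compact (C : R) (A : set M) :
  closed A -> (forall X, A X -> `|X| <= C) -> compact A.
Proof.
move=> clA bdA.
have -> : A = vec_mx @` (vec_mx @^-1` A : set 'rV[R]_(d * d)).
  rewrite eqEsubset; split=> [X AX|_ [v Av <-]//].
  by exists (mxvec X); rewrite /= mxvecK.
apply: continuous_compact.
  by apply: continuous_subspaceT; exact: vec_mx_continuous.
apply: bounded_closed_compact; last first.
  by apply: preimage_closed => // v _; exact: vec_mx_continuous.
exists C; split=> [|x Cx v /bdA vC]; first exact: num_real.
rewrite /Num.Def.normr/= mx_normrE; apply: bigmax_le => [|[i k] _].
  by rewrite (le_trans _ (ltW Cx))// (le_trans _ vC).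
rewrite /= (le_trans _ (ltW Cx))//; case/mxvec_indexP : k => k l.
have := mx_entry_le (vec_mx v : M) k l; rewrite mxE ord1 => /le_trans; exact.
Qed.

Lemma closed_norm_le (C : R) : closed [set X : M | `|X| <= C].
Proof.
apply: (@preimage_closed M R Num.Def.normr [set x : R | x <= C]); last exact: closed_le.
by move=> x _; exact: norm_continuous.
Qed.

Lemma mx_bounded_cluster (u : nat -> M) (C : R) : (forall n, `|u n| <= C) ->
  exists w, forall (e : R) N, 0 < e -> exists2 n, (N <= n)%N & `|u n - w| < e.
Proof.
move=> uC; pose A : set M := [set X | `|X| <= C].
have cA : compact A.
  by apply: (@mx_closed_ball_compact C) => //; exact: closed_norm_le.
have uA : (u @ \oo) A by exists 0%N => // n _; exact: uC.
have [w [_ cw]] := cA _ (fmap_proper_filter u _) uA.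
exists w => e N e0.
have [||_ [[n Nn <-] we]] := cw [set u n | n in [set n | (N <= n)%N]] (ball w e).
- by exists N => // n /= Nn; exists n.
- exact: nbhsx_ballx.
by exists n => //; rewrite distrC; move: we; rewrite -ball_normE.
Qed.

End MatrixCompact.

Section LocalOnto.
Context {R : realType} {d : nat}.
Local Notation M := 'M[R]_d.
Implicit Types (X Y V W : M).
Context (G : set M) (HG : closed_subgroup_GL G).

(** Regularity of the exponential at [S] as a map into G, so only directions in the Lie algebra
    count. *)
Definition Jinjective S := forall V, lie_alg G V -> Jexp S V = 0 -> V = 0.

Lemma Jexp_lie_inverse S : lie_alg G S -> Jinjective S ->
  exists K : {linear M -> M}, (forall V, lie_alg G V -> lie_alg G (K V)) /\
    (forall V, lie_alg G V -> Jexp S (K V) = V /\ K (Jexp S V) = V).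
Proof.
move=> hS Sinj; have [U hU] := lie_vspace HG.
pose L := linfun (Jexp S).
(* The Jacobian preserves the Lie algebra and has trivial kernel there, so equality of dimensions
   makes it onto. *)
have LUU : (L @: U = U)%VS.
  apply/eqP; rewrite eqEdim; apply/andP; split.
    apply/subvP => _ /memv_imgP[V VU ->]; rewrite lfunE /=.
    by apply/hU; apply: (lie_Jexp HG) => //; exact/hU.
  rewrite limg_dim_eq//; apply/eqP; rewrite -subv0; apply/subvP => V.
  rewrite memv_cap memv_ker lfunE /= => /andP[/hU hV /eqP JV].
  by rewrite (Sinj V hV JV) mem0v.
have surj V : exists W, lie_alg G V -> lie_alg G W /\ Jexp S W = V.
  have [hV|hV] := pselect (lie_alg G V); last by exists 0.
  move: hV => /hU; rewrite -LUU => /memv_imgP[W WU ->]; exists W => _.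
  by rewrite lfunE; split => //; exact/hU.
have [D hD] := choice surj.
have Dinj V W : lie_alg G V -> lie_alg G W -> Jexp S V = Jexp S W -> V = W.
  move=> hV hW JVW; apply/eqP; rewrite -subr_eq0; apply/eqP; apply: Sinj.
    exact: lieB.
  by rewrite linearB /= JVW subrr.
have [|K hK] := @lie_linear_extension _ _ _ HG D.
  move=> a X Y hX hY; have [gX JX] := hD _ hX; have [gY JY] := hD _ hY.
  have hXY : lie_alg G (a *: X + Y) by apply: lieD => //; exact: lieZ.
  have [gXY JXY] := hD _ hXY; apply: Dinj; first exact: gXY.
    by apply: (lieD HG) gY; exact: lieZ.
  by rewrite linearP /= JX JY.
exists K; split=> V hV; first by rewrite -hK//; have [] := hD _ hV.
rewrite -!hK//; last exact: lie_Jexp.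
have [gV JV] := hD _ hV; split=> //.
have [gJ JJ] := hD _ (lie_Jexp HG hS hV).
exact: Dinj.
Qed.

Lemma expm_dist_continuous S (g : M) :
  continuous (fun W : M => `|g - expm (S + W)|).
Proof.
apply: (@continuous_dist_le R M R^o) => W e e0.
have [C C0 hC] := @expm_lipschitz R d (`|S + W| + 1).
exists (Num.min 1 (e / (C + 1))).
  by rewrite lt_min ltr01 divr_gt0// ltr_wpDl.
move=> V; rewrite lt_min => /andP[/ltW V1 /ltW V2].
rewrite (le_trans (ler_dist_dist _ _))// opprB addrC addrA subrK.
have := hC 1 (S + W) (S + V); rewrite !scale1r ler01 lexx => /(_ isT).
rewrite lerDl ler01 => /(_ isT) h.
rewrite (le_trans (h _))//.
  rewrite (_ : S + V = (S + W) - (W - V)); last by rewrite opprB addrA addrAC addrK.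
  by rewrite (le_trans (ler_normB _ _))// lerD2l.
rewrite opprD addrACA subrr add0r distrC (le_trans (ler_wpM2l C0 V2))//.
rewrite mulrCA ler_piMr ?(ltW e0)//.
by rewrite ler_pdivrMr ?mul1r ?lerDl// ltr_wpDl.
Qed.

(* Let [e^(S+W)], with [W] in the Lie algebra, be closest to [g]. If it were not [g]
   itself, the direction [w] from it to [g] would be tangent to [G] at [e^S], so
   that moving along [g] by [J(S)^-1 (e^-S w)] would come closer still. *)
Lemma expm_local_onto S : lie_alg G S -> Jinjective S ->
  exists C del : R, [/\ 0 <= C, 0 < del &
    forall g, G g -> `|g - expm S| < del ->
      exists W, [/\ lie_alg G W, `|W| <= C * `|g - expm S| & expm (S + W) = g]].
Proof.
move=> hS Sinj.
have [K [Klie KJ]] := Jexp_lie_inverse hS Sinj.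
have [cK cK0 hcK] := linear_bounded K.
have [C C0 hC] := @expm_strict_diff R d (`|S| + 1).
have [CL CL0 hCL] := @expm_lipschitz R d (`|S| + 1).
(* For W in the Lie algebra, |W| <= kap |e^S J_S W|. *)
set kap := cK * (d%:R * `|expm (- S)|).
have kap0 : 0 <= kap by rewrite mulr_ge0// mulr_ge0.
have Ck0 : 0 < 4 * C * kap + 1 by rewrite ltr_wpDl// !mulr_ge0.
(* Chosen so that, on the ball of radius [eps], the nonlinear remainder costs at most a quarter of
   |W| in [inj]. *)
set eps := Num.min 1 (1 / (4 * C * kap + 1)).
have iCk : 0 < 1 / (4 * C * kap + 1) by rewrite divr_gt0.
have eps0 : 0 < eps by rewrite lt_min ltr01 iCk.
have eps1 : eps <= 1 by rewrite ge_min lexx.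
have epsC : 4 * C * kap * eps <= 1.
  rewrite (@le_trans _ _ ((4 * C * kap + 1) * (1 / (4 * C * kap + 1))))//.
    by rewrite ler_pM ?lerDl// ?mulr_ge0 ?(ltW eps0)// !ge_min lexx !orbT.
  by rewrite mul1r mulfV// gt_eqF.
have Sball W : `|W| <= eps -> `|S + W| <= `|S| + 1.
  by move=> We; rewrite (le_trans (ler_normD _ _))// lerD2l (le_trans We).
have Sb : `|S| <= `|S| + 1 by rewrite lerDl.
(* Strict differentiability, because the comparison point [S + W'] moves as well. *)
have strict W W' : `|W| <= eps -> `|W'| <= eps ->
    `|expm (S + W) - expm (S + W') - expm S *m Jexp S (W - W')| <=
    C * (`|W| + `|W'|) * `|W - W'|.
  move=> We W'e; have := hC S (S + W) (S + W') Sb (Sball _ We) (Sball _ W'e).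
  by rewrite opprD addrACA subrr add0r ![S + _ - S]addrC !addKr.
have inj W : lie_alg G W -> `|W| <= eps -> `|W| <= 2 * kap * `|expm (S + W) - expm S|.
  move=> hW We; have := strict W 0 We; rewrite normr0 addr0 !subr0 !addr0.
  move=> /(_ (ltW eps0)) st.
  have st2 : `|expm S *m Jexp S W| <= `|expm (S + W) - expm S| + C * eps * `|W|.
    rewrite -[X in `|X|](subKr (expm (S + W) - expm S)).
    rewrite (le_trans (ler_normB _ _))// lerD2l (le_trans st)//.
    by rewrite ler_wpM2r// ler_wpM2l.
  have : `|W| <= kap * `|expm S *m Jexp S W|.
    rewrite -[W in `|W|](KJ W hW).2 (le_trans (hcK _))// -mulrA ler_wpM2l//.
    rewrite -[X in `|X| <= _]mul1mx -(expmN S) -mulmxA (le_trans (mx_norm_mul _ _))//.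
  move=> h1; have {}h1 := le_trans h1 (ler_wpM2l kap0 st2).
  have h2 : 4 * C * kap * eps * `|W| <= `|W| by rewrite ler_piMl.
  have n1 := normr_ge0 W.
  rewrite mulrDr in h1.
  have h3 : 4 * (kap * (C * eps * `|W|)) <= `|W|.
    by rewrite (le_trans _ h2)// le_eqVlt; apply/orP; left; apply/eqP; ring.
  rewrite -mulrA; move: h1 h3 n1.
  move: (`|W|) (kap * (C * eps * `|W|)) (kap * `|_|) => c b a; lra.
apply: contrapT => hno.
(* Failure of the claim for the constants [2 * kap] and 1/(n+1) gives elements of G tending to e^S
   that the ball of radius [eps] misses; had one been reached, [inj] would give the required
   bound. *)
have bad n : exists g, [/\ G g, `|g - expm S| < n.+1%:R^-1 &
    forall W, lie_alg G W -> `|W| <= eps -> expm (S + W) <> g].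
  apply: contrapT => hn; apply: hno; exists (2 * kap), n.+1%:R^-1.
  split; [by rewrite mulr_ge0|by rewrite invr_gt0|].
  move=> g Gg gS; apply: contrapT => hW; apply: hn; exists g; split=> // W gW We Wg.
  by apply: hW; exists W; split=> //; rewrite -Wg; exact: inj.
have [g hg] := choice bad.
pose A : set M := [set W | lie_alg G W /\ `|W| <= eps].
have A0 : A 0 by split; [exact: lie0|rewrite normr0 ltW].
have cA : compact A.
  apply: (@mx_closed_ball_compact R d eps) => [|X []//].
  rewrite (_ : A = lie_alg G `&` [set X : M | `|X| <= eps])//.
  apply: closedI; last exact: closed_norm_le.
  move=> X clX; apply: (lie_closed HG) => r r0.
  have [Y [hY /=]] := clX _ (nbhsx_ballx X r r0).
  rewrite -ball_normE/= => /ltW XY; exists Y => //.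
  by rewrite distrC.
have minW n : exists W, A W /\ forall W', A W' -> `|g n - expm (S + W)| <= `|g n - expm (S + W')|.
  have [||W WA Wmin] := @compact_EVT_min M R (fun W => `|g n - expm (S + W)|) A _ cA.
  - by exists 0.
  - by apply: continuous_subspaceT; exact: expm_dist_continuous.
  exists W; split; first by rewrite inE in WA.
  by move=> W' AW'; apply: Wmin; rewrite inE.
have [W hW] := choice minW.
pose u n := g n - expm (S + W n).
have u0 n : 0 < `|u n|.
  rewrite normr_gt0 subr_eq0; apply/eqP => gW.
  by have [[WA We] _] := hW n; have [_ _ /(_ _ WA We)] := hg n; rewrite gW.
have uq n : `|u n| <= n.+1%:R^-1.
  have [_ /(_ _ A0)] := hW n; rewrite addr0 => /le_trans; apply.
  by have [_ /ltW] := hg n.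
have Wq n : `|W n| <= 4 * kap * n.+1%:R^-1.
  have [[WA We] _] := hW n; rewrite (le_trans (inj _ WA We))//.
  rewrite [leRHS](_ : _ = 2 * kap * (n.+1%:R^-1 + n.+1%:R^-1)); last by ring.
  rewrite ler_wpM2l ?mulr_ge0//.
  rewrite (_ : expm (S + W n) - expm S = (g n - expm S) - u n); last first.
    by rewrite /u opprB [RHS]addrC subrKA.
  rewrite (le_trans (ler_normB _ _))// lerD//.
  by have [_ /ltW] := hg n.
(* The residuals tend to 0, but their directions have norm 1 and accumulate. *)
have [w hw] := @mx_bounded_cluster R d (fun n => `|u n|^-1 *: u n) 1 (fun n =>
   ltac:(by rewrite normrZ normfV normr_id mulVf ?gt_eqF)).
have {}hw (eta : R) (q : R) : 0 < eta -> 0 < q -> exists n,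
    n.+1%:R^-1 < q /\ `|u n - `|u n| *: w| <= eta * `|u n|.
  move=> eta0 q0; have [n Nn nw] := hw eta (Num.trunc q^-1) eta0.
  exists n; split.
    rewrite invf_plt ?posrE//.
    have /andP[_ h] := truncn_itv (ltW (etrans (invr_gt0 q) q0)).
    by rewrite (lt_le_trans h)// ler_nat.
  have E : u n = `|u n| *: (`|u n|^-1 *: u n).
    by rewrite scalerA mulfV ?scale1r// gt_eqF.
  by rewrite {1}E -scalerBr normrZ normr_id mulrC ler_wpM2r// ltW.
(* The tangent sequence is e^{-(S + W n)} g_n = 1 + e^{-(S + W n)} u_n, which lies in G and is 1 +
   |u_n| e^{-S} w up to a small multiple of |u_n|. *)
have hSw : lie_alg G (expm (- S) *m w).
  apply: (lie_tangent HG) => r r0.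
  set K1 := d%:R * (CL * (4 * kap)); set K2 := d%:R * `|expm (- S)|.
  have K10 : 0 <= K1 by rewrite !mulr_ge0.
  have K20 : 0 <= K2 by rewrite !mulr_ge0.
  have q0 : 0 < Num.min r (r / 2 / (K1 + 1)).
    by rewrite lt_min r0 !divr_gt0// ltr_wpDl.
  have eta0 : 0 < r / 2 / (K2 + 1) by rewrite !divr_gt0// ltr_wpDl.
  have [n [nq un]] := hw _ _ eta0 q0.
  move: nq; rewrite lt_min => /andP[nr nq].
  have [[WA We] _] := hW n; have [Gg _ _] := hg n.
  exists (expm (- (S + W n)) *m g n), `|u n|; split=> //.
  - apply: (groupM HG) => //; apply: (lie_exp (X := - (S + W n))).
    by apply: (lieN); exact: lieD.
  - by rewrite (le_lt_trans (uq n)).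
  rewrite (_ : _ - _ - _ = (expm (- (S + W n)) - expm (- S)) *m u n +
      expm (- S) *m (u n - `|u n| *: w)); last first.
    rewrite /u; mxexp; rewrite expmN.
    by mxabel.
  rewrite (le_trans (ler_normD _ _))// [r in r * _](splitr r) mulrDl lerD//.
    rewrite (le_trans (mx_norm_mul _ _))// ler_wpM2r//.
    rewrite (@le_trans _ _ (K1 * (r / 2 / (K1 + 1))))//; last first.
      rewrite mulrCA ler_piMr ?divr_ge0 ?(ltW r0)//.
      by rewrite ler_pdivrMr ?mul1r ?lerDl// ltr_wpDl.
    rewrite /K1 -mulrA ler_wpM2l// -mulrA.
    have := hCL 1 (- S) (- (S + W n)); rewrite !scale1r ler01 lexx !normrN.
    move=> /(_ isT Sb (Sball _ We))/le_trans; apply.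
    rewrite ler_wpM2l// opprD addrAC subrr add0r normrN (le_trans (Wq n))//.
    by rewrite ler_wpM2l ?mulr_ge0// ltW.
  rewrite (le_trans (mx_norm_mul _ _))// (le_trans (ler_wpM2l K20 un))//.
  rewrite mulrA ler_wpM2r// mulrCA ler_piMr ?divr_ge0 ?(ltW r0)//.
  by rewrite ler_pdivrMr ?mul1r ?lerDl// ltr_wpDl.
set W' := K (expm (- S) *m w).
have hW' : lie_alg G W' by exact: Klie.
have JW' : expm S *m Jexp S W' = w.
  by rewrite (KJ _ hSw).1 mulmxA expmNr mul1mx.
(* [K1] controls the remainder between [W n] and [W n + |u n| W']: each contributes 4 kap, the
   second also |W'|. [K2] keeps the moved point in the ball. *)
set K1 := C * (8 * kap + `|W'|) * `|W'|; set K2 := 4 * kap + `|W'|.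
have K10 : 0 <= K1 by rewrite !mulr_ge0// addr_ge0// mulr_ge0.
have K20 : 0 <= K2 by rewrite addr_ge0// mulr_ge0.
have q0 : 0 < Num.min (2^-1 / (K1 + 1)) (eps / (K2 + 1)).
  by rewrite lt_min !divr_gt0// ltr_wpDl.
have eta0 : (0 : R) < 4^-1 by rewrite invr_gt0.
have [n [nq un]] := hw _ _ eta0 q0.
move: nq; rewrite lt_min => /andP[/ltW nK1 /ltW nK2].
have [[WA We] Wmin] := hW n.
have qn0 : 0 <= n.+1%:R^-1 :> R by rewrite invr_ge0.
have rW'q : `| `|u n| *: W'| <= `|W'| * n.+1%:R^-1.
  by rewrite normrZ normr_id mulrC ler_wpM2l.
have Xe : `|W n + `|u n| *: W'| <= eps.
  rewrite (le_trans (ler_normD _ _))// (@le_trans _ _ (K2 * n.+1%:R^-1))//.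
    by rewrite /K2 mulrDl lerD.
  rewrite (le_trans (ler_wpM2l K20 nK2))// mulrCA ler_piMr ?(ltW eps0)//.
  by rewrite ler_pdivrMr ?mul1r ?lerDl// ltr_wpDl.
have XA : A (W n + `|u n| *: W').
  by split=> //; apply: lieD => //; exact: lieZ.
have := Wmin _ XA; rewrite -/(u n) leNgt => /negP; apply.
have E : W n + `|u n| *: W' - W n = `|u n| *: W' by rewrite addrAC subrr add0r.
have st := strict _ _ Xe We; rewrite E in st.
rewrite (_ : g n - _ = (u n - `|u n| *: w) -
   (expm (S + (W n + `|u n| *: W')) - expm (S + W n) -
    expm S *m Jexp S (`|u n| *: W'))); last first.
  rewrite (linearZZ (Jexp S)) -scalemxAr JW' /u.
  by mxabel.
rewrite (le_lt_trans (ler_normB _ _))//.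
(* A quarter for the deviation of u_n from |u_n| w, a half for the nonlinear remainder: the moved
   point beats the minimum. *)
rewrite (@le_lt_trans _ _ (4^-1 * `|u n| + 2^-1 * `|u n|))//; last first.
  by have := u0 n; lra.
rewrite lerD// (le_trans st)//.
rewrite (@le_trans _ _ (K1 * n.+1%:R^-1 * `|u n|))//; last first.
  rewrite ler_wpM2r// (le_trans (ler_wpM2l K10 nK1))// mulrCA ler_piMr//.
  by rewrite ler_pdivrMr ?mul1r ?lerDl// ltr_wpDl.
rewrite (_ : K1 * n.+1%:R^-1 * `|u n| =
   C * ((8 * kap + `|W'|) * n.+1%:R^-1) * (`|u n| * `|W'|)); last first.
  by rewrite /K1; ring.
rewrite normrZ normr_id ler_wpM2r ?mulr_ge0// ler_wpM2l//.
rewrite (le_trans (lerD (ler_normD _ _) (lexx _)))//.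
rewrite (_ : (8 * kap + `|W'|) / n.+1%:R = 4 * kap / n.+1%:R +
   `|W'| / n.+1%:R + 4 * kap / n.+1%:R); last by ring.
by rewrite (lerD (lerD (Wq n) rW'q) (Wq n)).
Qed.

End LocalOnto.

(** * Singularities of the Jacobian *)

Section JacobianSingularities.
Context {R : realType} {d : nat}.
Local Notation M := 'M[R]_d.
Implicit Types (X Y V W Z : M).

Lemma conjfD X V (s t : R) : conjf X V (s + t) = conjf X (conjf X V t) s.
Proof.
rewrite /conjf [expm ((s + t) *: - X)]expmD [s + t]addrC.
by rewrite [expm ((t + s) *: X)]expmD !mulmxA.
Qed.

Lemma conjf_Jf X V (s t : R) : conjf X (Jf X V s) t = Jf X (conjf X V t) s.
Proof.
apply: (@Jf_unique R d X _ (fun s => conjf X (Jf X V s) t)) => [x|]; last first.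
  by rewrite /conjf Jf0 mulmx0 mul0mx.
rewrite -conjfD addrC conjfD.
exact: (is_derive_lin (mulmxr (expm (t *: X)) \o mulmx (expm (t *: - X)))
  (is_derive_Jf X V x)).
Qed.

Lemma Jf_add X V (s t : R) : Jf X V (s + t) = Jf X V t + Jf X (conjf X V t) s.
Proof.
apply/eqP; rewrite [X in _ == X]addrC -subr_eq; apply/eqP.
apply: (@Jf_unique R d X _ (fun s => Jf X V (s + t) - Jf X V t)) => [x|]; last first.
  by rewrite add0r subrr.
rewrite -conjfD.
have := @is_derive_reparam R d (Jf X V) t 1 x _ (is_derive_Jf X V (t + 1 * x)).
rewrite scale1r mul1r [t + x]addrC => h.
have := is_deriveB h (is_derive_cst (Jf X V t) x 1).
move/is_derive_eq; rewrite subr0 => /(_ _ erefl).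
rewrite (_ : (fun s => _ - _) = (fun s => Jf X V (t + 1 * s)) - cst (Jf X V t))//.
apply/funext => y.
by rewrite -[RHS]/(Jf X V (t + 1 * y) - Jf X V t) mul1r [y + t]addrC.
Qed.

(** The arguments are reordered so that the partial application is a linear map. *)
Definition Jft X (s : R) V := Jf X V s.

Fact Jft_is_linear X s : linear (Jft X s).
Proof. by move=> a V W; exact: Jf_linear. Qed.

HB.instance Definition _ X s :=
  GRing.isLinear.Build R M M *:%R (Jft X s) (Jft_is_linear X s).

(** Both operators are functions of [ad X]; uniqueness of primitives expresses this without a
    functional calculus. *)
Lemma Jft_comm X V (s t : R) : Jft X t (Jft X s V) = Jft X s (Jft X t V).
Proof.
apply/esym; apply: (@Jf_unique R d X _ (fun t => Jft X s (Jf X V t))) => [x|].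
  rewrite /Jft conjf_Jf; exact: (is_derive_lin (Jft X s) (is_derive_Jf X V x)).
by rewrite Jf0 linear0.
Qed.

(* For small [t] the integral of [e^{-s ad X}] over [0, t] is close to [t]. *)
Lemma Jft_small X : exists2 del : R, 0 < del &
  forall (t : R) V, 0 < t -> t < del -> Jft X t V = 0 -> V = 0.
Proof.
have [CL CL0 hCL] := @expm_lipschitz R d `|X|.
set b := expR (d%:R * `|X|).
(* On [0, t] the integrand differs from V by at most K t |V|, and [del] makes K t at most 1/2. *)
set K := d%:R * d%:R * (CL * `|X|) * b + d%:R * (CL * `|X|).
have K0 : 0 <= K by rewrite addr_ge0 ?mulr_ge0 ?expR_ge0.
have K1 : 0 < K + 1 by rewrite ltr_wpDl.
exists (Num.min 1 (2^-1 / (K + 1))); first by rewrite lt_min ltr01 divr_gt0.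
move=> t V t0; rewrite lt_min => /andP[t1 tK] JV.
have t01 : 0 <= t <= 1 by rewrite !ltW.
have lip Y : `|Y| = `|X| -> forall s : R, 0 <= s <= t ->
    `|expm (s *: Y) - 1%:M| <= CL * (`|X| * t).
  move=> YX s /andP[s0 st]; have sY : `|s *: Y| <= `|X| * t.
    by rewrite normrZ ger0_norm// YX mulrC ler_wpM2l.
  have := hCL 1 0 (s *: Y); rewrite !scale1r expm0 subr0 ler01 lexx normr0.
  have sX : `|s *: Y| <= `|X| by rewrite (le_trans sY)// ler_piMr// ltW.
  move=> /(_ isT (normr_ge0 _) sX)/le_trans; apply.
  by rewrite ler_wpM2l.
have dphi (s : R) : is_derive s 1 (fun s : R => Jft X s V - s *: V) (conjf X V s - V).
  exact: is_deriveB (is_derive_Jf X V s) (is_derive_scale V s).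
have := @mx_MVT_le R d _ _ 0 t (2^-1 * `|V|) (ltW t0) _ (fun s _ => dphi s).
have h2 : (0 : R) <= 2^-1 by rewrite invr_ge0.
rewrite mulr_ge0// JV /Jft Jf0 scale0r subr0 sub0r subr0 normrN normrZ gtr0_norm//.
rewrite subr0 => /(_ isT) h.
apply/eqP; rewrite -normr_eq0 eq_le normr_ge0 andbT.
have : t * `|V| <= 2^-1 * `|V| * t.
  apply: h => s st.
  rewrite (_ : conjf X V s - V = (expm (s *: - X) - 1%:M) *m V *m expm (s *: X)
      + V *m (expm (s *: X) - 1%:M)); last first.
    by rewrite /conjf; mxexp; rewrite addrA subrK.
  rewrite (le_trans (ler_normD _ _))// (@le_trans _ _ (K * t * `|V|))//; last first.
    rewrite ler_wpM2r// (le_trans (ler_wpM2l K0 (ltW tK)))// mulrCA ler_piMr//.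
    by rewrite ler_pdivrMr ?mul1r ?lerDl.
  rewrite [leRHS](_ : _ = d%:R * d%:R * (CL * (`|X| * t) * `|V| * b) +
      d%:R * `|V| * (CL * (`|X| * t))); last by rewrite /K; ring.
  have sX : `|expm (s *: X)| <= b.
    move: st => /andP[s0 st]; apply: expm_ball_bound => //.
    by rewrite s0 (le_trans st)// ltW.
  rewrite lerD//.
    rewrite (le_trans (mx_norm_mul3 _ _ _))// ler_wpM2l ?mulr_ge0//.
    by rewrite ler_pM ?mulr_ge0// ler_wpM2r// lip ?normrN.
  by rewrite (le_trans (mx_norm_mul _ _))// ler_wpM2l ?mulr_ge0// lip.
have := normr_ge0 V; move: (`|V|) => v v0.
rewrite mulrAC [t * v]mulrC mulrAC [v * t]mulrC -mulrA [v * t]mulrC.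
rewrite mulrCA ler_pM2l// => hv; lra.
Qed.

(** If the integrals over [0, s] and [0, t] vanish, so does that over [s, t], which is the integral
    over [0, t - s] for the conjugate of V. The bound [del] is uniform in s. *)
Lemma Jft_kernels_disjoint X : exists2 del : R, 0 < del &
  forall (s t : R) V, s < t -> t - s < del ->
    Jft X s V = 0 -> Jft X t V = 0 -> V = 0.
Proof.
have [del del0 h] := Jft_small X; exists del => // s t V st tsd Js Jt.
have : Jft X (t - s) (conjf X V s) = 0.
  have := Jf_add X V (t - s) s; rewrite subrK.
  by rewrite -!/(Jft _ _ _) Js Jt add0r.
move=> /h; rewrite subr_gt0 => /(_ st tsd) cV.
rewrite -(conjf0 X V) -(addNr s) conjfD cV.
by rewrite /conjf mulmx0 mul0mx.
Qed.

(** The factors commute, so the product kills the kernels of all its factors; it serves to separate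
    a later kernel vector from the earlier ones. *)
Fixpoint Jft_prod X (s : nat -> R) (n : nat) : {linear M -> M} :=
  if n is k.+1 then Jft X (s k) \o Jft_prod X s k else idfun.

(* The kernels of [int_0^s e^{-u ad X} du] for close values of [s] are linearly
   independent, hence all but finitely many of them vanish. *)
Lemma Jexp_injective_near X (e : R) : 0 < e ->
  exists2 s : R, 1 - e < s < 1 & forall V, Jexp (s *: X) V = 0 -> V = 0.
Proof.
move=> e0; have [del del0 disj] := Jft_kernels_disjoint X.
apply: contrapT => hno.
(* The bound by [del] keeps any two of the values [s n] close enough for [disj]. *)
set e' := Num.min e (Num.min del 1).
have e'0 : 0 < e' by rewrite !lt_min e0 del0 ltr01.
have e'e : e' <= e by rewrite ge_min lexx.
have e'd : e' <= del by rewrite !ge_min lexx orbT.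
pose s (n : nat) : R := 1 - e' / n.+2%:R.
have s1 n : 1 - e' < s n < 1.
  have h1 : 0 < e' / n.+2%:R by rewrite divr_gt0.
  have h2 : e' / n.+2%:R < e' by rewrite ltr_pdivrMr// ltr_pMr// ltr1n.
  by rewrite /s; move: (e' / _) h1 h2 => x h1 h2; apply/andP; split; lra.
have smono m n : (m < n)%N -> s m < s n.
  move=> mn; rewrite ltrD2l ltrN2 ltr_pM2l// ltf_pV2 ?posrE//.
  by rewrite ltr_nat.
have bad n : exists V, V <> 0 /\ Jft X (s n) V = 0.
  apply: contrapT => hn; apply: hno; exists (s n).
    by have /andP[h1 ->] := s1 n; rewrite andbT (le_lt_trans _ h1)// lerD2l lerN2.
  move=> V JV; apply: contrapT => V0; apply: hn; exists V; split=> //.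
  by rewrite /Jft -Jexp_scale JV scaler0.
have [V hV] := choice bad.
(* By commutation the partial product of [V n] stays in the kernel for [s n]; were it also in that
   for [s k], it would vanish by [disj]. *)
have Vprod n k : (k <= n)%N -> Jft_prod X s k (V n) <> 0 /\
    Jft X (s n) (Jft_prod X s k (V n)) = 0.
  elim: k => [_|k IH kn]; first exact: hV.
  have [P0 JP] := IH (ltnW kn); split=> /=; last first.
    by rewrite Jft_comm JP linear0.
  move=> P1; apply: P0; apply: (disj (s k) (s n)) => //; first exact: smono.
  rewrite (@lt_le_trans _ _ e')//.
  have /andP[h1 h2] := s1 k; have /andP[h3 h4] := s1 n; lra.
(* The product of the first n operators kills the span of [vs] but not [V n], so [V n] can be
   added. *)
have indep n : exists vs : seq M, [/\ size vs = n, free vs &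
    forall v, v \in vs -> Jft_prod X s n v = 0].
  elim: n => [|n [vs [szvs fvs hvs]]].
    by exists [::]; split=> //; exact: nil_free.
  exists (V n :: vs); split; first by rewrite /= szvs.
    rewrite free_cons fvs andbT; apply/negP => Vvs.
    have [P0 _] := Vprod n n (leqnn n); apply: P0.
    have : (<<vs>> <= lker (linfun (Jft_prod X s n)))%VS.
      apply/span_subvP => v vvs; rewrite memv_ker lfunE /=.
      by rewrite hvs.
    by move/subvP/(_ _ Vvs); rewrite memv_ker lfunE /= => /eqP.
  move=> v; rewrite inE => /orP[/eqP ->|vvs] /=.
    by have [_] := Vprod n n (leqnn n).
  by rewrite hvs// linear0.
have [vs [szvs fvs _]] := indep (\dim {:M}).+1.
have := dimvS (subvf <<vs>>%VS); move: fvs; rewrite /free => /eqP ->.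
by rewrite szvs ltnn.
Qed.

End JacobianSingularities.

(** * Derivations *)

Section DerivationFlow.
Context {R : realType} {d : nat}.
Local Notation M := 'M[R]_d.
Implicit Types (X Y V W Z : M).

Lemma adN_Jf X V (t : R) : Jf X V t *m X - X *m Jf X V t = conjf X V t - V.
Proof.
apply/eqP; rewrite -subr_eq0; apply/eqP.
have h (s : R) : is_derive s 1 (fun s : R => adN X (Jf X V s) - (conjf X V s - V)) 0.
  have h1 := is_derive_lin (adN X) (is_derive_Jf X V s).
  have h2 := is_deriveB (is_derive_conjf X V s) (is_derive_cst V s 1).
  have := is_deriveB h1 h2.
  by move/is_derive_eq; apply; rewrite subr0 subrr.
have := is_derive_mx0_cst h t 0; rewrite Jf0 linear0 conjf0 subrr subrr.
by [].
Qed.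

(** Here X enters linearly and not through e^{-tX}, so the equation can be perturbed in X. *)
Lemma is_derive_Jf_ode X V (t : R) :
  is_derive t 1 (Jf X V) (Jf X V t *m X - X *m Jf X V t + V).
Proof. by rewrite adN_Jf subrK; exact: is_derive_Jf. Qed.

(** A Gronwall-type bound from the integrating factor; one [K] serves all X with |X| <= rho, hence
    both X and X + W below. *)
Lemma conj_ode_bound (rho : R) : exists2 K : R, 0 <= K &
  forall X (phi w : R -> M) (c : R), `|X| <= rho -> 0 <= c -> phi 0 = 0 ->
    (forall t : R, is_derive t 1 phi (phi t *m X - X *m phi t + w t)) ->
    (forall t : R, 0 <= t <= 1 -> `|w t| <= c) ->
    forall t : R, 0 <= t <= 1 -> `|phi t| <= K * c.
Proof.
set b := expR (d%:R * rho); have b0 : 0 <= b by exact: expR_ge0.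
set k := (d%:R * d%:R) * (b * b); have k0 : 0 <= k by rewrite !mulr_ge0.
exists (k * k); first exact: mulr_ge0.
move=> X phi w c Xr c0 phi0 dphi wc t /andP[t0 t1].
have conjb (s : R) (A B V : M) : 0 <= s <= 1 -> `|A| <= rho -> `|B| <= rho ->
    `|expm (s *: A) *m V *m expm (s *: B)| <= k * `|V|.
  move=> s01 Ar Br; rewrite (le_trans (mx_norm_mul3 _ _ _))// /k -[leRHS]mulrA.
  rewrite ler_wpM2l ?mulr_ge0// mulrAC ler_wpM2r// ler_pM// expm_ball_bound//.
have := mx_MVT_le t0 (mulr_ge0 k0 c0) (fun s _ => is_derive_conj_ode (dphi s)).
rewrite phi0 mulmx0 mul0mx subr0 => h.
have {}h : `|expm (t *: X) *m phi t *m expm (t *: - X)| <= k * c.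
  rewrite (le_trans (h _))// => [s /andP[s0 st]|]; last first.
    by rewrite subr0 ler_piMr ?mulr_ge0.
  have s01 : 0 <= s <= 1 by rewrite s0 (le_trans st).
  by rewrite (le_trans (conjb _ _ _ _ s01 _ _)) ?normrN// ler_wpM2l// wc.
have -> : phi t = expm (t *: - X) *m
   (expm (t *: X) *m phi t *m expm (t *: - X)) *m expm (t *: X).
  rewrite !mulmxA expmNscale mul1mx -mulmxA expmNscale mulmx1//.
by rewrite (le_trans (conjb _ _ _ _ _ _ _)) ?t0 ?normrN// -mulrA ler_wpM2l.
Qed.

Context (G : set M) (HG : closed_subgroup_GL G).
Context (L : {linear M -> M}).
Hypothesis Lbr : forall X Y, lie_alg G X -> lie_alg G Y ->
  L (lie_br X Y) = lie_br (L X) Y + lie_br X (L Y).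

(* [s |-> L B - [B, H]], with [B = Jf X W] and [H = Jf X (L X)], is the solution of
   the variational equation of [H' = L X - [X, H]] in the direction [W]. *)
Lemma Jf_derivation_frechet X : lie_alg G X -> exists2 K : R, 0 <= K &
  forall W, lie_alg G W -> `|W| <= 1 ->
  `|Jexp (X + W) (L (X + W)) - Jexp X (L X) -
    (L (Jexp X W) - lie_br (Jexp X W) (Jexp X (L X)))| <= K * `|W| * `|W|.
Proof.
move=> hX; have [K K0 hK] := conj_ode_bound (`|X| + 1).
have [CL CL0 hL] := linear_bounded L.
set rho := `|X| + 1 in hK *.
have rho0 : 0 <= rho by rewrite addr_ge0.
have Xrho : `|X| <= rho by rewrite lerDl.
set c1 := K * (CL * rho); have c10 : 0 <= c1 by rewrite !mulr_ge0.
set c2 := K * (CL + (d%:R + d%:R) * c1).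
have c20 : 0 <= c2 by rewrite !(mulr_ge0, addr_ge0).
have brb (A B : M) : `|lie_br A B| <= (d%:R + d%:R) * `|A| * `|B|.
  rewrite (le_trans (ler_normB _ _))// !mulrDl; apply: lerD; first exact: mx_norm_mul.
  by rewrite (le_trans (mx_norm_mul _ _))// mulrAC.
exists (K * ((d%:R + d%:R) * c2)); first by rewrite !(mulr_ge0, addr_ge0).
move=> W hW W1; set P := X + W.
have Prho : `|P| <= rho by rewrite (le_trans (ler_normD _ _))// lerD2l.
set H := Jf X (L X); set Hp := Jf P (L P); set B := Jf X W.
have dH := is_derive_Jf_ode X (L X); rewrite -/H in dH.
have dHp := is_derive_Jf_ode P (L P); rewrite -/Hp in dHp.
have dB := is_derive_Jf_ode X W; rewrite -/B in dB.
have Hpb (t : R) : 0 <= t <= 1 -> `|Hp t| <= c1.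
  apply: (hK P Hp (fun=> L P) _ Prho); rewrite ?mulr_ge0//.
    by rewrite /Hp Jf0.
  by move=> s _; rewrite (le_trans (hL _))// ler_wpM2l.
have Delb (t : R) : 0 <= t <= 1 -> `|Hp t - H t| <= c2 * `|W|.
  rewrite /c2 -mulrA.
  apply: (hK X (fun t => Hp t - H t) (fun t => L W + lie_br (Hp t) W) _ Xrho).
  - by rewrite !(mulr_ge0, addr_ge0).
  - by rewrite /Hp /H !Jf0 subrr.
  - move=> s; have := is_deriveB (dHp s) (dH s).
    move/is_derive_eq; apply; rewrite /P /lie_br (linearD L).
    by move: (Hp s) (H s) => ? ?; mxexp; mxabel.
  - move=> s s01; rewrite mulrDl (le_trans (ler_normD _ _))// lerD//.
    by rewrite (le_trans (brb _ _))// ler_wpM2r// ler_wpM2l ?addr_ge0// Hpb.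
pose C t := L (B t) - lie_br (B t) (H t).
have dC (t : R) : is_derive t 1 C (C t *m X - X *m C t + (L W - lie_br W (H t))).
  have h1 := is_derive_lin L (dB t).
  have h2 := is_deriveB (is_derive_mulmx (dB t) (dH t)) (is_derive_mulmx (dH t) (dB t)).
  have := is_deriveB h1 h2; move/is_derive_eq; apply.
  (* The derivation rule for [B, X] produces [B, L X], which cancels the same term of [B, H']; the
     Jacobi identity collects the rest. *)
  have hB : lie_alg G (B t) by exact: lie_Jf.
  have := Lbr hB hX; rewrite /lie_br (linearD L _ W) /C /lie_br => ->.
  by move: (H t) (B t) (L (B t)) => ? ? ?; mxexp; mxabel.
(* The forcing terms of first order cancel; what remains is [Hp - H, W], quadratic in |W| by
   [Delb]. *)
have delb : `|Hp 1 - H 1 - C 1| <= K * ((d%:R + d%:R) * (c2 * `|W|) * `|W|).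
  have i01 : 0 <= (1 : R) <= 1 by rewrite ler01 lexx.
  apply: (hK X (fun t => Hp t - H t - C t) (fun t => lie_br (Hp t - H t) W) _ Xrho _ _ _ _ _ i01).
  - by rewrite !(mulr_ge0, addr_ge0).
  - by rewrite /C /Hp /H /B !Jf0 subrr linear0 /lie_br mulmx0 !subrr.
  - move=> s; have := is_deriveB (is_deriveB (dHp s) (dH s)) (dC s).
    move/is_derive_eq; apply; rewrite /P /lie_br (linearD L).
    by move: (Hp s) (H s) (C s) => ? ? ?; mxexp; mxabel.
  - move=> s s01; rewrite (le_trans (brb _ _))// ler_wpM2r//.
    by rewrite ler_wpM2l ?addr_ge0// Delb.
rewrite !JexpE (le_trans delb)// le_eqVlt; apply/orP; left; apply/eqP; ring.
Qed.

Lemma is_derive_Jexp_derivation (X : R -> M) (t : R) V :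
  (forall s, lie_alg G (X s)) -> is_derive t 1 X V ->
  is_derive t 1 (fun s => Jexp (X s) (L (X s)))
    (L (Jexp (X t) V) - lie_br (Jexp (X t) V) (Jexp (X t) (L (X t)))).
Proof.
move=> hX dX; have [K K0 hK] := Jf_derivation_frechet (hX t).
pose H := Jexp (X t) (L (X t)).
pose L' : {linear M -> M} := (L \o Jexp (X t)) \-
   ((mulmxr H \o Jexp (X t)) \- (mulmx H \o Jexp (X t))).
apply: (@is_derive_frechet R d (lie_alg G) (fun X => Jexp X (L X)) L' X t V) dX.
  by move=> s; exact: lieB.
move=> e e0; have eK : 0 < e / (K + 1) by rewrite divr_gt0// ltr_wpDl.
exists (Num.min 1 (e / (K + 1))); first by rewrite lt_min ltr01.
move=> W hW; rewrite lt_min => /andP[/ltW W1 /ltW We].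
rewrite (le_trans (hK W hW W1))// ler_wpM2r// (le_trans (ler_wpM2l K0 We))//.
rewrite mulrCA ler_piMr ?(ltW e0)//.
by rewrite ler_pdivrMr ?mul1r ?lerDl// ltr_wpDl.
Qed.

End DerivationFlow.

(** * From the representation to group-affinity *)

Section VectorFieldDerivative.
Context {R : realType} {d : nat}.
Local Notation M := 'M[R]_d.
Implicit Types (X Y V W Z : M).

Lemma is_derive_unique (phi : R -> M) (t : R) V W :
  is_derive t 1 phi V -> is_derive t 1 phi W -> V = W.
Proof. by move=> [_ <-] [_ <-]. Qed.

Lemma within_continuous_dist (S : set M) (F : M -> M) X (e : R) :
  {within S, continuous F} -> S X -> 0 < e ->
  exists2 del : R, 0 < del &
    forall Y, S Y -> `|X - Y| < del -> `|F X - F Y| <= e.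
Proof.
move=> /subspace_continuousP h SX e0.
have /cvgrPdist_le/(_ _ e0) := h X SX.
rewrite near_withinE => /nbhs_ballP[del /= del0 hd]; exists del => // Y SY XY.
by apply: hd => //; rewrite -ball_normE.
Qed.

Context (G : set M) (HG : closed_subgroup_GL G).

(** A local logarithm chosen pointwise. The linear bound on |W| from [expm_local_onto] is enough to
    make this arbitrary choice differentiable at 0. *)
Lemma curve_lift S (gam : R -> M) B : lie_alg G S -> Jinjective G S ->
  (forall r, G (gam r)) -> gam 0 = expm S -> lie_alg G B ->
  is_derive (0 : R) 1 gam (expm S *m B) ->
  exists (W : R -> M) (W1 : M) (del : R), [/\ 0 < del,
    forall r, lie_alg G (W r), W 0 = 0 /\ Jexp S W1 = B, is_derive (0 : R) 1 W W1 &
    forall r : R, `|r| < del -> expm (S + W r) = gam r].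
Proof.
move=> hS Sinj Ggam gam0 hB dgam.
have [C [del [C0 del0 onto]]] := expm_local_onto HG hS Sinj.
have [K [Klie KJ]] := Jexp_lie_inverse HG hS Sinj.
have [cK cK0 hcK] := linear_bounded K.
(* Far from e^S the default 0 keeps the whole curve in the Lie algebra. *)
have ex r : exists W, lie_alg G W /\ (`|gam r - expm S| < del ->
    `|W| <= C * `|gam r - expm S| /\ expm (S + W) = gam r).
  have [near|far] := ltP `|gam r - expm S| del.
    by have [W [hW WC EW]] := onto _ (Ggam r) near; exists W.
  by exists 0; split; [exact: lie0|].
have [W hW] := choice ex.
have W0 : W 0 = 0.
  have [_] := hW 0; rewrite gam0 subrr normr0 mulr0 => /(_ del0)[+ _].
  by move=> h; apply/eqP; rewrite -normr_eq0 eq_le h normr_ge0.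
have [JK _] := KJ B hB.
move/is_derive_dist_le : dgam => dgam.
set Cg := `|expm S *m B| + 1.
have Cg0 : 0 < Cg by rewrite ltr_wpDl.
have [d1 d10 h1] := dgam 1 ltr01.
have gamr (r : R) : `|r| < d1 -> `|gam r - expm S| <= Cg * `|r|.
  move=> rd1; have := h1 r rd1; rewrite add0r gam0 mul1r => h.
  rewrite -(subrK (r *: (expm S *m B)) (gam r - expm S)).
  rewrite (le_trans (ler_normD _ _))// /Cg mulrDl mul1r addrC lerD//.
  by rewrite normrZ mulrC.
set d2 := Num.min d1 (del / Cg).
have d20 : 0 < d2 by rewrite lt_min d10 divr_gt0.
have neard (r : R) : `|r| < d2 -> `|gam r - expm S| < del.
  rewrite lt_min => /andP[r1 r2]; rewrite (le_lt_trans (gamr r r1))//.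
  by rewrite mulrC -ltr_pdivlMr.
exists W, (K B), d2; split=> //.
- by move=> r; have [] := hW r.
- apply/is_derive_dist_le => e e0.
  set c1 := cK * (d%:R * `|expm (- S)|).
  have c10 : 0 <= c1 by rewrite !mulr_ge0.
  have e1 : 0 < e / 2 / (c1 + 1) by rewrite !divr_gt0// ltr_wpDl.
  have CCg : 0 <= c1 * (C * Cg) by rewrite !mulr_ge0// ltW.
  have e2 : 0 < e / 2 / (c1 * (C * Cg) + 1) by rewrite !divr_gt0// ltr_wpDl.
  have [d3 d30 h3] := dgam _ e1.
  have [d4 d40 h4] := expm_frechet S e2.
  have CCg1 : 0 < C * Cg + 1 by rewrite ltr_wpDl// mulr_ge0// ltW.
  exists (Num.min d2 (Num.min d3 (d4 / (C * Cg + 1)))).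
    by rewrite lt_min d20 lt_min d30 divr_gt0.
  move=> r; rewrite lt_min => /andP[rd2]; rewrite lt_min => /andP[rd3 rd4].
  have rd1 : `|r| < d1 by move: rd2; rewrite lt_min => /andP[].
  rewrite add0r W0 subr0.
  have [lieW /(_ (neard r rd2))[WC EW]] := hW r.
  have {}WC : `|W r| <= C * Cg * `|r|.
    by rewrite (le_trans WC)// -mulrA ler_wpM2l// gamr.
  have Wd4 : `|W r| < d4.
    rewrite (le_lt_trans WC)// (@le_lt_trans _ _ ((C * Cg + 1) * `|r|))//.
      by rewrite ler_wpM2r// lerDl.
    by rewrite mulrC -ltr_pdivlMr.
  have {}h3 := h3 r rd3; rewrite add0r gam0 in h3.
  have {}h4 := h4 _ Wd4; rewrite EW in h4.
  have lieD1 : lie_alg G (W r - r *: K B).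
    by apply: (lieB HG) => //; apply: lieZ; exact: Klie.
  (* Seen through e^S J_S, the error of W is the error of [gam] minus that of the linearized
     exponential; both are small. *)
  have E : expm S *m Jexp S (W r - r *: K B) =
      (gam r - expm S - r *: (expm S *m B)) -
      (gam r - expm S - expm S *m Jexp S (W r)).
    rewrite (linearB (Jexp S)) (linearZZ (Jexp S)) /= JK mulmxBr -scalemxAr.
    by mxabel.
  have : `|W r - r *: K B| <= c1 * `|expm S *m Jexp S (W r - r *: K B)|.
    rewrite -[X in `|X| <= _](KJ _ lieD1).2 (le_trans (hcK _))// -mulrA ler_wpM2l//.
    by rewrite -[X in `|X| <= _]mul1mx -(expmN S) -mulmxA (le_trans (mx_norm_mul _ _)).
  move=> /le_trans; apply; rewrite E.
  rewrite (le_trans (ler_wpM2l c10 (ler_normB _ _)))// mulrDr.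
  rewrite [leRHS](_ : _ = e / 2 * `|r| + e / 2 * `|r|); last by rewrite -mulrDl -splitr.
  apply: lerD.
    rewrite (le_trans (ler_wpM2l c10 h3))// mulrA ler_wpM2r// mulrCA.
    rewrite ler_piMr ?divr_ge0 ?(ltW e0)//.
    by rewrite ler_pdivrMr ?mul1r ?lerDl// ltr_wpDl.
  rewrite (le_trans (ler_wpM2l c10 h4))//.
  rewrite (@le_trans _ _ (c1 * (e / 2 / (c1 * (C * Cg) + 1) * (C * Cg * `|r|))))//.
    by rewrite ler_wpM2l// ler_wpM2l// ltW.
  rewrite [leLHS](_ : _ = (e / 2 * ((c1 * (C * Cg)) / (c1 * (C * Cg) + 1))) * `|r|); last by ring.
  rewrite ler_wpM2r// ler_piMr ?divr_ge0 ?(ltW e0)//.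
  by rewrite ler_pdivrMr ?mul1r ?lerDl// ltr_wpDl.
- by move=> r /neard; have [_ h] := hW r; move=> /h[].
Qed.

Context (L : {linear M -> M}) (Y1 Y2 : M) (f : M -> M).
Hypothesis Lbr : forall X Y, lie_alg G X -> lie_alg G Y ->
  L (lie_br X Y) = lie_br (L X) Y + lie_br X (L Y).
Hypothesis fE : forall X, lie_alg G X ->
  f (expm X) = expm X *m Jexp X (L X) + expm X *m Y1 + Y2 *m expm X.

(** With J = J_S (L S), the derivative of J is L B - [B, J]; the commutator turns e^S B J into e^S J
    B, the missing part of f(e^S) B. *)
Lemma is_derive_field_regular S (gam : R -> M) B :
  lie_alg G S -> Jinjective G S ->
  (forall r, G (gam r)) -> gam 0 = expm S -> lie_alg G B ->
  is_derive (0 : R) 1 gam (expm S *m B) ->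
  is_derive (0 : R) 1 (fun r => f (gam r))
    (expm S *m (L B + B *m Y1 - Y1 *m B) + f (expm S) *m B).
Proof.
move=> hS Sinj Ggam gam0 hB dgam.
have [W [W1 [del [del0 hW [W0 JW1] dW EW]]]] := curve_lift hS Sinj Ggam gam0 hB dgam.
pose X r := S + W r.
have hX r : lie_alg G (X r) by exact: lieD.
have X0 : X 0 = S by rewrite /X W0 addr0.
have dX : is_derive (0 : R) 1 X W1.
  have := is_deriveD (is_derive_cst S (0 : R) 1) dW.
  by move/is_derive_eq; apply; rewrite add0r.
have d1 := is_derive_expm_path dX.
have d2 := is_derive_Jexp_derivation HG Lbr hX dX.
rewrite X0 JW1 in d1 d2.
apply: (@is_derive_near _ _ (fun r => expm (X r) *m Jexp (X r) (L (X r)) +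
    expm (X r) *m Y1 + Y2 *m expm (X r)) _ _ _ _ del0) => [h hdel|].
  by rewrite add0r -fE// -EW.
have d3 := is_deriveD (is_deriveD (is_derive_mulmx d1 d2)
   (is_derive_lin (mulmxr Y1) d1)) (is_derive_lin (mulmx Y2) d1).
move: d3 => /is_derive_eq; apply; rewrite X0 fE// /lie_br /=; mxexp.
by mxabel.
Qed.

End VectorFieldDerivative.

Section GroupAffineFields.
Context {R : realType} {d : nat}.
Local Notation M := 'M[R]_d.
Implicit Types (X Y V W Z : M).
Context (G : set M) (HG : closed_subgroup_GL G) (Gexp : exp_surjective G).
Context (f : M -> M) (fsmooth : smooth_vector_field G f).

Lemma chart_derivable g X V : G g -> lie_alg G X -> lie_alg G V ->
  derivable (fun X => f (g *m expm X)) X V.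
Proof.
move=> Gg hX hV; have [_ /(_ g Gg) sm] := fsmooth.
by have [|h _] := sm [::]; [by move=> v; rewrite in_nil|exact: h].
Qed.

Lemma chart_derive_continuous g V : G g -> lie_alg G V ->
  {within lie_alg G, continuous (fun X => 'D_V (fun X => f (g *m expm X)) X)}.
Proof.
move=> Gg hV; have [_ /(_ g Gg) sm] := fsmooth.
by have [|_ h] := sm [:: V]; [by move=> v; rewrite inE => /eqP ->|exact: h].
Qed.

Section Representation.
Context (L : {linear M -> M}) (Y1 Y2 : M).
Hypothesis Lbr : forall X Y, lie_alg G X -> lie_alg G Y ->
  L (lie_br X Y) = lie_br (L X) Y + lie_br X (L Y).
Hypothesis fE : forall X, lie_alg G X ->
  f (expm X) = expm X *m Jexp X (L X) + expm X *m Y1 + Y2 *m expm X.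

Lemma is_derive_cvg_dnbhs (phi : R -> M) (t : R) V :
  is_derive t 1 phi V -> phi @ t^' --> phi t.
Proof.
move=> /is_derive_cvg h; apply: cvg_trans h; apply: cvg_app; exact: cvg_within.
Qed.

Lemma cvg_Jexp_scale Z Y : (fun u : R => Jexp (u *: Z) Y) @ (0 : R)^' --> Y.
Proof.
apply/cvgrPdist_le => e e0.
have := is_derive_Jf Z Y 0; rewrite conjf0 => /is_derive_dist_le/(_ e e0)[del del0 h].
near=> u; have u0 : u != 0 by near: u; exact: nbhs_dnbhs_neq.
have := h u; rewrite add0r Jf0 subr0 -Jexp_scale -scalerBr normrZ [e * _]mulrC.
rewrite ler_pM2l ?normr_gt0// distrC; apply.
by near: u; exact: dnbhs0_lt.
Unshelve. all: by end_near. Qed.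

(* At [g = e^Z] with [J(Z)] singular the formula is obtained as a limit of the
   regular points [e^((1+u)Z) = g e^(uZ)] in the chart centred at [g]. *)
Lemma is_derive_field g Y : G g -> lie_alg G Y ->
  is_derive (0 : R) 1 (fun r : R => f (g *m expm (r *: Y)))
    (g *m (L Y + Y *m Y1 - Y1 *m Y) + f g *m Y).
Proof.
move=> Gg hY; have [Z [hZ gZ]] := Gexp Gg.
set F := fun X => f (g *m expm X).
have E : is_derive (0 : R) 1 (fun r : R => f (g *m expm (r *: Y))) ('D_Y F 0).
  have := @is_derive_line R d F 0 Y 0; rewrite scale0r addr0.
  move=> /(_ (chart_derivable Gg (lie0 HG) hY)).
  by under [X in is_derive _ _ X _]eq_fun do rewrite add0r.
suff <- : 'D_Y F 0 = g *m (L Y + Y *m Y1 - Y1 *m Y) + f g *m Y by [].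
(* At r = 0 the chart curve g e^{uZ + rY} has left-trivialized velocity J_{uZ} Y, which is Y only in
   the limit. *)
pose B (u : R) := Jexp (u *: Z) Y.
pose Psi (u : R) := (g *m expm (u *: Z)) *m (L (B u) + B u *m Y1 - Y1 *m B u) +
  F (u *: Z) *m B u.
have PsiE (u : R) : (forall V, Jexp ((1 + u) *: Z) V = 0 -> V = 0) ->
    'D_Y F (u *: Z) = Psi u.
  move=> inj; set S := (1 + u) *: Z.
  have hS : lie_alg G S by exact: lieZ.
  have huZ : lie_alg G (u *: Z) by exact: lieZ.
  have eS : expm S = g *m expm (u *: Z) by rewrite -gZ /S expmD scale1r.
  have hB : lie_alg G (B u) by exact: lie_Jexp.
  have dl : is_derive (0 : R) 1 (fun r : R => u *: Z + r *: Y) Y by exact: is_derive_lineZ.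
  pose gam (r : R) := g *m expm (u *: Z + r *: Y).
  have dgam : is_derive (0 : R) 1 gam (expm S *m B u).
    have := is_derive_lin (mulmx g) (is_derive_expm_path dl).
    by move/is_derive_eq; apply; rewrite /= scale0r addr0 eS mulmxA.
  have Ggam r : G (gam r).
    by apply: (groupM HG) => //; apply: lie_exp; apply: (lieD HG) => //; exact: lieZ.
  have gam0 : gam 0 = expm S by rewrite /gam scale0r addr0.
  have Sinj : Jinjective G S by move=> V _; exact: inj.
  have h1 := is_derive_field_regular HG Lbr fE hS Sinj Ggam gam0 hB dgam.
  have := @is_derive_line R d F (u *: Z) Y 0; rewrite scale0r addr0.
  move=> /(_ (chart_derivable Gg huZ hY)) h2.
  by rewrite (is_derive_unique h2 h1) eS.
have cexp : (fun u : R => g *m expm (u *: Z)) @ (0 : R)^' --> g.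
  have := is_derive_cvg_dnbhs (is_derive_lin (mulmx g) (is_derive_expm Z 0)).
  rewrite /= scale0r expm0 mulmx1.
  by [].
have cF : (fun u : R => F (u *: Z)) @ (0 : R)^' --> f g.
  have := @is_derive_line R d F 0 Z 0; rewrite scale0r addr0.
  move=> /(_ (chart_derivable Gg (lie0 HG) hZ))/is_derive_cvg_dnbhs.
  rewrite /= scale0r addr0 {2}/F expm0 mulmx1.
  under [X in X @ _]eq_fun do rewrite add0r.
  by [].
have cB : B @ (0 : R)^' --> Y by exact: cvg_Jexp_scale.
have cPsi : Psi @ (0 : R)^' --> g *m (L Y + Y *m Y1 - Y1 *m Y) + f g *m Y.
  pose L' : {linear M -> M} := (L \+ mulmxr Y1) \- mulmx Y1.
  apply: cvgD; last exact: cvg_mulmx.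
  apply: cvg_mulmx; first exact: cexp.
  have cL : (fun u => L' (B u)) @ (0 : R)^' --> L' Y by apply: cvg_linear.
  exact: cL.
(* The equality with [Psi u] is known only for some small u, so both limits are compared at one such
   u, each within a third of the supposed gap. *)
apply/eqP; rewrite -subr_eq0 -normr_eq0; apply/negPn/negP => ne0.
set D0 := 'D_Y F 0 in ne0 *; set P0 := _ + f g *m Y in ne0 cPsi *.
have e0 : 0 < `|D0 - P0| / 3 by rewrite divr_gt0// lt_def ne0 normr_ge0.
have [del del0 hdel] := within_continuous_dist (chart_derive_continuous Gg hY) (lie0 HG) e0.
have /cvgrPdist_le/(_ _ e0) := cPsi.
rewrite /dnbhs near_withinE => /nbhs_ballP[del2 /= del20 hdel2].
have m0 : 0 < Num.min del2 (del / (`|Z| + 1)).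
  by rewrite lt_min del20 divr_gt0// ltr_wpDl.
have [s /andP[s1 s2] inj] := @Jexp_injective_near R d Z _ m0.
pose u := s - 1.
have u0 : u < 0 by rewrite subr_lt0.
have ud : `|u| < Num.min del2 (del / (`|Z| + 1)).
  by rewrite ltr0_norm// opprB ltrBlDl -ltrBlDr.
move: ud; rewrite lt_min => /andP[ud2 ud1].
have h1 := PsiE u; rewrite /u addrC subrK -/u in h1.
have {}h1 := h1 inj.
have h2 : `|P0 - Psi u| <= `|D0 - P0| / 3.
  by apply: hdel2; [rewrite /ball/= sub0r normrN|rewrite lt_eqF].
have h3 : `|D0 - Psi u| <= `|D0 - P0| / 3.
  rewrite -h1; apply: hdel; first exact: lieZ.
  rewrite sub0r normrN normrZ (@le_lt_trans _ _ (`|u| * (`|Z| + 1)))//.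
    by rewrite ler_wpM2l// lerDl.
  by rewrite -ltr_pdivlMr// ltr_wpDl.
have : `|D0 - P0| <= `|D0 - P0| / 3 + `|D0 - P0| / 3.
  rewrite -{1}(subrKA (Psi u)) (le_trans (ler_normD _ _))// lerD//.
  by rewrite distrC.
move: e0; move: (`|D0 - P0|) => x; lra.
Unshelve. all: by end_near. Qed.

Lemma representation_group_affine : group_affine G f.
Proof.
move=> g g2 Gg Gg2; have [Y [hY <-]] := Gexp Gg2.
(* The derivative at time t is the one at time 0 with base point g' e^{tY}. *)
have dq g' : G g' -> forall t : R, is_derive t 1 (fun t : R => f (g' *m expm (t *: Y)))
   (g' *m expm (t *: Y) *m (L Y + Y *m Y1 - Y1 *m Y) + f (g' *m expm (t *: Y)) *m Y).
  move=> Gg' t; set x := g' *m expm (t *: Y).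
  have Gx : G x by exact: groupM.
  have h0 : is_derive (- t + 1 * t) 1 (fun r : R => f (x *m expm (r *: Y)))
      (x *m (L Y + Y *m Y1 - Y1 *m Y) + f x *m Y).
    by rewrite mul1r addNr; exact: is_derive_field.
  have := is_derive_reparam h0; rewrite scale1r.
  rewrite (_ : (fun s => _) = (fun t : R => f (g' *m expm (t *: Y))))//.
  by apply/funext => s; rewrite /x -mulmxA -expmD mul1r addrA subrr add0r.
pose Q (t : R) := (f (g *m expm (t *: Y)) - g *m f (1%:M *m expm (t *: Y))) *m
  expm (t *: - Y).
have dQ (t : R) : is_derive t 1 Q 0.
  have h1 := is_deriveB (dq g Gg t) (is_derive_lin (mulmx g) (dq _ (group1 HG) t)).
  have := is_derive_mulmx h1 (is_derive_expm (- Y) t).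
  move/is_derive_eq; apply => /=; rewrite !mul1mx; mxexp.
  by mxabel.
have := is_derive_mx0_cst dQ 1 0; rewrite /Q !scale1r !scale0r expm0 !mulmx1 !mul1mx => h.
have : f (g *m expm Y) - g *m f (expm Y) = (f g - g *m f 1%:M) *m expm Y.
  by rewrite -h -mulmxA expmN mulmx1.
move/eqP; rewrite subr_eq => /eqP ->; rewrite mulmxBl.
by rewrite addrAC.
Qed.

Lemma group_affine_error_ode (X mu : R -> M) (T : set R) :
  (forall X, lie_alg G X -> lie_alg G (L X)) -> lie_alg G Y2 ->
  open T ->
  (forall t, T t -> lie_alg G (X t) /\ derivable X t 1) ->
  (forall t, T t -> [/\ G (mu t), derivable mu t 1 & derive1 mu t = f (mu t)]) ->
  (forall t, T t ->
     derivable (fun s => expm (X s) *m mu s) t 1 /\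
     derive1 (fun s => expm (X s) *m mu s) t = f (expm (X t) *m mu t)) ->
  (forall t, T t -> forall V W, lie_alg G V -> lie_alg G W ->
     Jexp (X t) V = Jexp (X t) W -> V = W) ->
  group_affine G f ->
  forall t, T t -> derive1 X t = L (X t) + lie_br Y2 (X t).
Proof.
move=> Llie hY2 oT hX hmu hg Jinj fga t Tt.
have [hXt dX] := hX t Tt; have [Gmu dmu mu'] := hmu t Tt.
have [dg g'] := hg t Tt.
have dX' : is_derive t 1 X (derive1 X t).
  exact: (DeriveDef dX (esym (derive1E X t))).
have dmu' : is_derive t 1 mu (f (mu t)).
  exact: (DeriveDef dmu (etrans (esym (derive1E mu t)) mu')).
have dg' : is_derive t 1 (fun s => expm (X s) *m mu s) (f (expm (X t) *m mu t)).
  exact: (DeriveDef dg (etrans (esym (derive1E _ t)) g')).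
(* Injectivity of the Jacobian is assumed only on the Lie algebra; openness of [T] puts the
   difference quotients there. *)
have lieX' : lie_alg G (derive1 X t).
  have [r /= r0 rT] := (nbhs_ballP _ _).1 (open_nbhs_nbhs (conj oT Tt)).
  apply: (@lie_derive_near _ _ _ HG X t r _ r0 _ dX') => h hr.
  have [] // := hX (t + h) _; apply: rT.
  by rewrite /ball/= opprD addrA subrr sub0r normrN.
apply: (Jinj t Tt); first exact: lieX'.
  by apply: (lieD HG); [exact: Llie|exact: lie_bracket].
have := is_derive_unique dg' (is_derive_mulmx (is_derive_expm_path dX') dmu').
rewrite (fga _ _ (lie_exp hXt) Gmu) => h.
have h2 : (expm (X t) *m Jexp (X t) (derive1 X t)) *m mu t =
    (f (expm (X t)) - expm (X t) *m f 1%:M) *m mu t.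
  apply: (addIr (expm (X t) *m f (mu t))); rewrite -h mulmxBl.
  by rewrite addrAC.
have h3 := congr1 (fun A => A *m invmx (mu t)) h2.
rewrite /= !(mulmxK (group_unit HG Gmu)) in h3.
rewrite -[LHS]mul1mx -(expmN (X t)) -mulmxA h3.
have f1 : f 1%:M = Y1 + Y2.
  by have := fE (lie0 HG); rewrite expm0 linear0 linear0 mulmx0 add0r mul1mx mulmx1.
(* The conjugate of Y2 is itself a primitive of the conjugate of [Y2, X]. *)
have J2 : Jexp (X t) (lie_br Y2 (X t)) = expm (- X t) *m Y2 *m expm (X t) - Y2.
  have dc (s : R) : is_derive s 1 (conjf (X t) Y2) (conjf (X t) (lie_br Y2 (X t)) s).
    have c2 : X t *m expm (s *: - X t) = expm (s *: - X t) *m X t.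
      by have := expm_comm (- X t) s; rewrite mulmxN mulNmx => /oppr_inj.
    have := is_derive_conjf (X t) Y2 s.
    move/is_derive_eq; apply; rewrite /conjf /lie_br.
    rewrite -(mulmxA _ (expm (s *: X t)) (X t)) expm_comm !mulmxA c2; mxexp.
    by mxabel.
  by rewrite (Jexp_primitive dc) conjf0 /conjf !scale1r.
rewrite (linearD (Jexp (X t))) /= J2 (fE hXt) f1; mxexp; rewrite expmN; mxexp.
by mxabel.
Qed.

End Representation.

End GroupAffineFields.

(** * From group-affinity to the representation *)

Section DirectionalDerivative.
Context {R : realType} {d : nat}.
Local Notation M := 'M[R]_d.
Implicit Types (X Y V W : M).

Lemma slope_additive (t r : R) (a b e x y z : M) : 0 < t ->
  `|a - b - t *: x| <= r * t -> `|e - t *: y - a| <= r * t ->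
  `|e - b - t *: z| <= r * t -> `|z - (x + y)| <= 3 * r.
Proof.
move=> t0 h1 h2 h3; rewrite -(ler_pM2l t0) -{1}(gtr0_norm t0) -normrZ.
rewrite (_ : t *: (z - (x + y)) =
  (a - b - t *: x) + (e - t *: y - a) - (e - b - t *: z)); last by mxabel.
rewrite (le_trans (ler_normB _ _))// [leRHS](_ : _ = r * t + r * t + r * t); last by ring.
by rewrite lerD// (le_trans (ler_normD _ _))// lerD.
Qed.

(** The increment to t(X + Y) is split at tX. On the second leg the mean value inequality and the
    continuity of the derivative along Y replace F' at tX by F' at 0. *)
Lemma derive_additive (S : set M) (F : M -> M) X Y :
  S 0 -> (forall V W, S V -> S W -> S (V + W)) -> (forall (a : R) V, S V -> S (a *: V)) ->
  (forall V W, S V -> S W -> derivable F V W) ->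
  {within S, continuous (fun V => 'D_Y F V)} -> S X -> S Y ->
  'D_(X + Y) F 0 = 'D_X F 0 + 'D_Y F 0.
Proof.
move=> S0 SD SZ dF cF SX SY; have SXY := SD _ _ SX SY.
have line V : S V -> forall e : R, 0 < e ->
    exists2 del : R, 0 < del & forall t : R, `|t| < del ->
    `|F (t *: V) - F 0 - t *: 'D_V F 0| <= e * `|t|.
  move=> SV e e0; have := @is_derive_line R d F 0 V 0; rewrite scale0r addr0.
  move=> /(_ (dF _ _ S0 SV))/is_derive_dist_le/(_ _ e0)[del del0 h].
  by exists del => // t /h; rewrite !add0r scale0r.
apply/eqP; rewrite -subr_eq0 -normr_eq0; apply/negPn/negP => ne0.
pose D0 := `|'D_(X + Y) F 0 - ('D_X F 0 + 'D_Y F 0)|.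
have D00 : 0 < D0 by rewrite lt_def ne0 normr_ge0.
(* Three errors of D0 / 4 add up to less than D0. *)
have e0 : 0 < D0 / 4 by rewrite divr_gt0.
have [d1 d10 h1] := line _ SX _ e0; have [d2 d20 h2] := line _ SXY _ e0.
have [d3 d30 h3] := within_continuous_dist cF S0 e0.
have XY1 : 0 < `|X| + `|Y| + 1 by rewrite ltr_wpDl// addr_ge0.
have m0 : 0 < Num.min d1 (Num.min d2 (d3 / (`|X| + `|Y| + 1))).
  by rewrite lt_min d10 lt_min d20 divr_gt0.
have [t [t0]] : exists t : R, 0 < t /\ t < Num.min d1 (Num.min d2 (d3 / (`|X| + `|Y| + 1))).
  exists (Num.min d1 (Num.min d2 (d3 / (`|X| + `|Y| + 1))) / 2).
  by rewrite divr_gt0// ltr_pdivrMr// ltr_pMr// ltr1n.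
rewrite lt_min => /andP[td1]; rewrite lt_min => /andP[td2 td3].
have {}h1 := h1 t; have {}h2 := h2 t; rewrite gtr0_norm// in h1 h2.
have {}h1 := h1 td1; have {}h2 := h2 td2.
have dphi (s : R) : is_derive s 1 (fun s : R => F (t *: X + s *: Y) - s *: 'D_Y F 0)
    ('D_Y F (t *: X + s *: Y) - 'D_Y F 0).
  apply: is_deriveB (is_derive_scale _ _); apply: is_derive_line.
  by apply: (dF _ _ _ SY); apply: SD; exact: SZ.
have := mx_MVT_le (ltW t0) (ltW e0) (fun s _ => dphi s).
rewrite !scale0r addr0 !subr0 => h4.
have {}h4 : `|F (t *: X + t *: Y) - t *: 'D_Y F 0 - F (t *: X)| <= D0 / 4 * t.
  apply: h4 => s /andP[s0 st]; rewrite distrC; apply: h3.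
    by apply: SD; exact: SZ.
  rewrite sub0r normrN (le_lt_trans (ler_normD _ _))// !normrZ !ger0_norm ?(ltW t0)//.
  rewrite (@le_lt_trans _ _ (t * (`|X| + `|Y| + 1)))//; last by rewrite -ltr_pdivlMr.
  by rewrite !mulrDr -[leLHS]addr0 lerD ?mulr1 ?(ltW t0)// lerD// ler_wpM2r.
rewrite scalerDr in h2.
have : D0 <= 3 * (D0 / 4) := slope_additive t0 h1 h4 h2.
move=> hD; clearbody D0; clear -D00 hD; lra.
Qed.

End DirectionalDerivative.

Section GroupAffineNecessity.
Context {R : realType} {d : nat}.
Local Notation M := 'M[R]_d.
Implicit Types (X Y V W Z : M).
Context (G : set M) (HG : closed_subgroup_GL G).
Context (f : M -> M) (fsmooth : smooth_vector_field G f).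

Hypothesis fga : group_affine G f.
Local Notation c := (f 1%:M).
Local Notation F := (fun X => f (1%:M *m expm X)).

(** This is the derivative at 0 of e^{-tX} f(e^{tX}), a curve in the Lie algebra. *)
Definition field_derivation X : M := 'D_X F 0 - X *m c.

Lemma lie_field1 : lie_alg G c.
Proof.
have [/(_ _ (group1 HG)) + _] := fsmooth.
by rewrite invmx1 mul1mx.
Qed.

Lemma is_derive_field1 X : lie_alg G X ->
  is_derive (0 : R) 1 (fun t : R => f (expm (t *: X))) (field_derivation X + X *m c).
Proof.
move=> hX; rewrite /field_derivation subrK.
have := @is_derive_line R d F 0 X 0; rewrite scale0r addr0.
move=> /(_ (chart_derivable fsmooth (group1 HG) (lie0 HG) hX)).
by under [X in is_derive _ _ X _]eq_fun do rewrite add0r mul1mx.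
Qed.

Lemma lie_field_derivation X : lie_alg G X -> lie_alg G (field_derivation X).
Proof.
move=> hX; pose phi (t : R) := expm (t *: - X) *m f (expm (t *: X)) - c.
apply: (@lie_derive _ _ _ HG phi 0) => [t|].
  apply: (lieB HG); last exact: lie_field1.
  have [/(_ _ (hX t)) + _] := fsmooth.
  by rewrite invmx_expm scalerN.
have := is_deriveB (is_derive_mulmx (is_derive_expm (- X) 0) (is_derive_field1 hX))
  (is_derive_cst c (0 : R) 1).
move/is_derive_eq; apply; rewrite !scale0r expm0; mxexp.
by mxabel.
Qed.

Lemma field_derivationZ (a : R) X : lie_alg G X ->
  field_derivation (a *: X) = a *: field_derivation X.
Proof.
move=> hX.
have h1 := is_derive_field1 (lieZ a hX).
have h2 : is_derive (0 + a * 0) 1 (fun t : R => f (expm (t *: X)))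
    (field_derivation X + X *m c).
  by rewrite mulr0 addr0; exact: is_derive_field1.
have {}h2 := is_derive_reparam h2.
rewrite (_ : (fun s => _) = fun t : R => f (expm (t *: (a *: X)))) in h2; last first.
  by apply/funext => s; rewrite add0r scalerA mulrC.
have := is_derive_unique h1 h2; rewrite scalerDr -scalemxAl.
by move/addIr.
Qed.

Lemma field_derivationD X Y : lie_alg G X -> lie_alg G Y ->
  field_derivation (X + Y) = field_derivation X + field_derivation Y.
Proof.
move=> hX hY; rewrite /field_derivation mulmxDl opprD addrACA; congr (_ + _).
apply: (@derive_additive R d (lie_alg G) F) => //.
- exact: lie0.
- by move=> V W; exact: lieD.
- by move=> a V; exact: lieZ.
- by move=> V W hV hW; exact: (chart_derivable fsmooth (group1 HG)).
- exact: (chart_derive_continuous fsmooth (group1 HG)).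
Qed.

(** Group-affinity makes f(g e^{tY} g^-1) affine in e^{tY} and f(e^{tY}), so it can be
    differentiated at t = 0 for fixed g. *)
Lemma field_derivation_conj g Y : G g -> lie_alg G Y ->
  field_derivation (g *m Y *m invmx g) =
  f g *m Y *m invmx g + g *m field_derivation Y *m invmx g +
  g *m (Y *m c - c *m Y) *m invmx g - g *m Y *m invmx g *m f g *m invmx g.
Proof.
move=> Gg hY; have gu := group_unit HG Gg; set g' := invmx g.
have Gg' : G g' by exact: groupV.
have hgY : lie_alg G (g *m Y *m g') by exact: lie_conj.
(* Group-affinity applied to g g^-1 = 1 determines the value at the inverse. *)
have fg' : f g' = g' *m c - g' *m f g *m g' + c *m g'.
  have := fga Gg Gg'; rewrite mulmxV// => h.
  have : g *m f g' = c - f g *m g' + g *m c *m g'.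
    by rewrite [X in _ = X - _ + _]h; mxabel.
  move/(congr1 (mulmx g')); rewrite mulmxA mulVmx// mul1mx => ->.
  by mxexp; rewrite mulVmx// mul1mx.
have E (t : R) : f (expm (t *: (g *m Y *m g'))) =
    f g *m expm (t *: Y) *m g' + g *m f (expm (t *: Y)) *m g' -
    g *m c *m expm (t *: Y) *m g' + g *m expm (t *: Y) *m g' *m c -
    g *m expm (t *: Y) *m g' *m f g *m g'.
  rewrite expm_conj// fga//; last by apply: groupM.
  rewrite (fga Gg (hY t)) fg'; mxexp; mxabel.
have h1 := is_derive_field1 hgY.
have dY := is_derive_expm Y 0; rewrite scale0r expm0 mulmx1 in dY.
have dfY := is_derive_field1 hY.
have h2 : is_derive (0 : R) 1 (fun t : R => f (expm (t *: (g *m Y *m g'))))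
  (f g *m Y *m g' + g *m (field_derivation Y + Y *m c) *m g' -
    g *m c *m Y *m g' + g *m Y *m g' *m c - g *m Y *m g' *m f g *m g').
  under [X in is_derive _ _ X _]eq_fun do rewrite E.
  have k1 := is_derive_lin (mulmxr g' \o mulmx (f g)) dY.
  have k2 := is_derive_lin (mulmxr g' \o mulmx g) dfY.
  have k3 := is_derive_lin (mulmxr g' \o mulmx (g *m c)) dY.
  have k4 := is_derive_lin (mulmxr c \o mulmxr g' \o mulmx g) dY.
  have k5 := is_derive_lin (mulmxr g' \o mulmxr (f g) \o mulmxr g' \o mulmx g) dY.
  exact: is_deriveB (is_deriveD (is_deriveB (is_deriveD k1 k2) k3) k4) k5.
have := is_derive_unique h1 h2 => /eqP; rewrite eq_sym -subr_eq => /eqP <-.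
by mxexp; mxabel.
Qed.

Lemma group_affine_representation :
  exists (D : M -> M) (Y1 Y2 : M), affine_repr G f D Y1 Y2.
Proof.
have Dlin (a : R) X Y : lie_alg G X -> lie_alg G Y ->
    field_derivation (a *: X + Y) = a *: field_derivation X + field_derivation Y.
  move=> hX hY; rewrite field_derivationD//; last exact: lieZ.
  by rewrite field_derivationZ.
have [L LE] := lie_linear_extension HG Dlin.
exists field_derivation, c, 0; split.
- split=> //; first exact: lie_field_derivation.
  move=> X Y hX hY.
  (* The linear extension lets the derivative pass inside; its value is compared with that of the
     conjugation formula for g = e^{sX}. *)
  have h1 : is_derive (0 : R) 1 (fun s : R => L (expm (s *: X) *m Y *m expm (s *: - X)))
      (L (lie_br X Y)).
    have := is_derive_lin L (is_derive_mulmx (is_derive_lin (mulmxr Y)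
      (is_derive_expm X 0)) (is_derive_expm (- X) 0)).
    move/is_derive_eq; apply; congr (L _); rewrite /= !scale0r expm0 /lie_br; mxexp.
    by mxabel.
  have E (s : R) : L (expm (s *: X) *m Y *m expm (s *: - X)) =
    f (expm (s *: X)) *m Y *m expm (s *: - X) +
    expm (s *: X) *m field_derivation Y *m expm (s *: - X) +
    expm (s *: X) *m (Y *m c - c *m Y) *m expm (s *: - X) -
    expm (s *: X) *m Y *m expm (s *: - X) *m f (expm (s *: X)) *m expm (s *: - X).
    rewrite -LE; last by rewrite scalerN -invmx_expm; exact: lie_conj.
    by have := field_derivation_conj (hX s) hY; rewrite invmx_expm -scalerN.
  have dX := is_derive_expm X 0; have dX' := is_derive_expm (- X) 0.
  rewrite scale0r expm0 mulmx1 in dX; rewrite scale0r expm0 mulmx1 in dX'.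
  have df := is_derive_field1 hX.
  have k1 := is_derive_mulmx (is_derive_lin (mulmxr Y) df) dX'.
  have k2 := is_derive_mulmx (is_derive_lin (mulmxr (field_derivation Y)) dX) dX'.
  have k3 := is_derive_mulmx (is_derive_lin (mulmxr (Y *m c - c *m Y)) dX) dX'.
  have k4 := is_derive_mulmx (is_derive_mulmx (is_derive_mulmx
    (is_derive_lin (mulmxr Y) dX) dX') df) dX'.
  have h2 := is_deriveB (is_deriveD (is_deriveD k1 k2) k3) k4.
  rewrite LE; last exact: lie_bracket.
  have EF := funext E; rewrite EF in h1.
  rewrite (is_derive_unique h1 h2) /= !scale0r expm0 /lie_br.
  move: (field_derivation X) (field_derivation Y) c => DX DY c0; mxexp.
  by mxabel.
- exact: lie_field1.
- exact: lie0.
- move=> X hX; rewrite mul0mx addr0.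
  pose psi (t : R) := expm (t *: - X) *m f (expm (t *: X)) - c.
  have dpsi (t : R) : is_derive t 1 psi (conjf X (field_derivation X) t).
    have dq : is_derive t 1 (fun t : R => f (expm (t *: X)))
        (field_derivation X *m expm (t *: X) + X *m f (expm (t *: X))).
      (* Group-affinity for e^{sX} = e^{(s-t)X} e^{tX} moves differentiation at t back to 0. *)
      have E (s : R) : f (expm (s *: X)) = f (expm ((- t + 1 * s) *: X)) *m expm (t *: X) +
          expm ((- t + 1 * s) *: X) *m (f (expm (t *: X)) - c *m expm (t *: X)).
        have := fga (hX (- t + s)) (hX t); rewrite -expmD addrAC addNr add0r mul1r => ->.
        by mxexp; rewrite addrA.
      under [X in is_derive _ _ X _]eq_fun do rewrite E.
      have h1 : is_derive (- t + 1 * t) 1 (fun s : R => f (expm (s *: X)))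
          (field_derivation X + X *m c).
        by rewrite mul1r addNr; exact: is_derive_field1.
      have h2 := is_derive_expm X (- t + 1 * t).
      have := is_deriveD (is_derive_lin (mulmxr (expm (t *: X))) (is_derive_reparam h1))
        (is_derive_lin (mulmxr (f (expm (t *: X)) - c *m expm (t *: X))) (is_derive_reparam h2)).
      move/is_derive_eq; apply; rewrite /= !scale1r mul1r addNr scale0r expm0; mxexp.
      by mxabel.
    have := is_deriveB (is_derive_mulmx (is_derive_expmr (- X) t) dq) (is_derive_cst c t 1).
    move/is_derive_eq; apply; rewrite /conjf; mxexp.
    by mxabel.
  have psi0 : psi 0 = 0 by rewrite /psi !scale0r expm0 mul1mx subrr.
  have := Jf_unique dpsi psi0 1; rewrite -JexpE /psi !scale1r => <-.
  by rewrite mulmxBr mulmxA expmNr mul1mx subrK.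
Qed.

End GroupAffineNecessity.

Theorem theorem1 (R : realType) (d : nat) (G : set 'M[R]_d) (f : 'M[R]_d -> 'M[R]_d) :
  closed_subgroup_GL G -> exp_surjective G -> smooth_vector_field G f ->
  (group_affine G f <->
     exists (D : 'M[R]_d -> 'M[R]_d) (Y1 Y2 : 'M[R]_d), affine_repr G f D Y1 Y2)
  /\
  (group_affine G f ->
   forall (D : 'M[R]_d -> 'M[R]_d) (Y1 Y2 : 'M[R]_d), affine_repr G f D Y1 Y2 ->
   forall (T : set R) (X mu : R -> 'M[R]_d),
     open T ->
     (forall t, T t -> lie_alg G (X t) /\ derivable X t 1) ->
     (forall t, T t -> [/\ G (mu t), derivable mu t 1 & derive1 mu t = f (mu t)]) ->
     (forall t, T t ->
        derivable (fun s => expm (X s) *m mu s) t 1 /\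
        derive1 (fun s => expm (X s) *m mu s) t = f (expm (X t) *m mu t)) ->
     (forall t, T t -> forall V W, lie_alg G V -> lie_alg G W ->
        Jexp (X t) V = Jexp (X t) W -> V = W) ->
     forall t, T t -> derive1 X t = D (X t) + lie_br Y2 (X t)).
Proof.
move=> HG Gexp fsmooth.
(* Off the Lie algebra [D] is arbitrary, so it is first replaced by a linear map that agrees with it
   there. *)
have linearize D Y1 Y2 : affine_repr G f D Y1 Y2 -> exists L : {linear 'M[R]_d -> 'M[R]_d},
    [/\ forall X, lie_alg G X -> D X = L X,
        forall X, lie_alg G X -> lie_alg G (L X),
        forall X Y, lie_alg G X -> lie_alg G Y ->
          L (lie_br X Y) = lie_br (L X) Y + lie_br X (L Y) &
        forall X, lie_alg G X ->
          f (expm X) = expm X *m Jexp X (L X) + expm X *m Y1 + Y2 *m expm X].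
  move=> [[Dlie Dlin Dbr] hY1 hY2 fE]; have [L LE] := lie_linear_extension HG Dlin.
  exists L; split; first exact: LE.
  - by move=> X hX; rewrite -(LE _ hX); exact: Dlie.
  - move=> X Y hX hY; rewrite -(LE _ hX) -(LE _ hY).
    by rewrite -(LE _ (lie_bracket HG hX hY)); exact: Dbr.
  - by move=> X hX; rewrite -(LE _ hX); exact: fE.
split; [split|].
- exact: group_affine_representation.
- move=> [D [Y1 [Y2 /linearize[L [_ _ Lbr fE]]]]].
  exact: (representation_group_affine HG Gexp fsmooth Lbr fE).
- move=> fga D Y1 Y2 DY T X mu oT hX hmu hg Jinj t Tt.
  have [L [LE Llie _ fE]] := linearize _ _ _ DY; have [_ _ hY2 _] := DY.
  rewrite LE; last by have [] := hX t Tt.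
  exact: (group_affine_error_ode HG fE Llie hY2 oT hX hmu hg Jinj fga Tt).
Qed.
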